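(* Let $M^5\subset\mathbb C^4$ be a maximally minimal CR-generic real analytic submanifold. In the first loop of Cartan's method (i.e. in the structure equations of the lifted coframe on $M\times G$ described in the context), five essential linear combinations of torsion coefficients appear: $$U_5=\frac1{\overline{\mathsf a}^2}\overline G-\frac{\mathsf b}{\mathsf a\overline{\mathsf a}^2}B-\frac{\overline{\mathsf b}}{\overline{\mathsf a}^3}\overline R+\frac{\overline{\mathsf d}}{\mathsf a\overline{\mathsf a}^2},\qquad U_6=\frac1{\overline{\mathsf a}}B-\frac{\overline{\mathsf c}}{\mathsf a\overline{\mathsf a}^2},\qquad U_7=\frac{\mathsf a}{\overline{\mathsf a}^2}\overline R,$$ $$U_3+\overline U_4-3V_8=\frac1{\mathsf a}Q-4\frac{\mathsf c}{\mathsf a^2\overline{\mathsf a}}+\frac1{\mathsf a}\overline B-3i\frac{\overline{\mathsf b}}{\mathsf a\overline{\mathsf a}},\qquad \overline U_4-V_8-\overline W_{10}=\frac1{\mathsf a}\overline B-\frac{\mathsf c}{\mathsf a^2\overline{\mathsf a}}.$$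
   Context: $M^5\subset\mathbb C^4$ is a local real analytic CR-generic graph $v_j=\varphi_j(x,y,u_1,u_2,u_3)$, $j=1,2,3$, in coordinates $z=x+iy$, $w_j=u_j+iv_j$, with $\varphi_j(0)=0$, $d\varphi_j(0)=0$. $\overline{\mathcal L}$ is the unique local generator of $T^{0,1}M$ of the intrinsic form $\partial_{\overline z}$ plus a combination of $\partial_{u_1},\partial_{u_2},\partial_{u_3}$; $\mathcal L$ is its conjugate; $\mathcal T:=i[\mathcal L,\overline{\mathcal L}]$, $\mathcal S:=[\mathcal L,\mathcal T]$, $\overline{\mathcal S}:=[\overline{\mathcal L},\mathcal T]$; maximally minimal means these five fields form a frame for $\mathbb C\otimes_{\mathbb R} TM$. Functions: $[\mathcal L,\mathcal S]=P\mathcal T+Q\mathcal S+R\overline{\mathcal S}$, $[\overline{\mathcal L},\mathcal S]=[\mathcal L,\overline{\mathcal S}]=A\mathcal T+B\mathcal S+\overline B\,\overline{\mathcal S}$, $[\mathcal T,\mathcal S]=E\mathcal T+F\mathcal S+G\overline{\mathcal S}$. Dual coframe of $\{\overline{\mathcal S},\mathcal S,\mathcal T,\overline{\mathcal L},\mathcal L\}$: $\{\overline\sigma_0,\sigma_0,\rho_0,\overline\zeta_0,\zeta_0\}$. $G$ is the real $10$-dimensional group with parameters $\mathsf a\in\mathbb C^*$, $\mathsf b,\mathsf c,\mathsf d,\mathsf e\in\mathbb C$, and the lifted coframe on $M\times G$ is $$\sigma=\mathsf a^2\overline{\mathsf a}\,\sigma_0,\quad \rho=\overline{\mathsf c}\,\overline\sigma_0+\mathsf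 c\,\sigma_0+\mathsf a\overline{\mathsf a}\,\rho_0,\quad \zeta=\overline{\mathsf d}\,\overline\sigma_0+\mathsf e\,\sigma_0+\mathsf b\,\rho_0+\mathsf a\,\zeta_0,$$ together with $\overline\sigma,\overline\zeta$. The Maurer–Cartan forms are $\alpha_1=\frac{d\mathsf a}{\mathsf a}$, $\alpha_2=\frac{d\mathsf c}{\mathsf a^2\overline{\mathsf a}}-\frac{\mathsf c\,d\mathsf a}{\mathsf a^3\overline{\mathsf a}}-\frac{\mathsf c\,d\overline{\mathsf a}}{\mathsf a^2\overline{\mathsf a}^2}$, $\alpha_3=-\frac{\mathsf c\,d\mathsf b}{\mathsf a^3\overline{\mathsf a}^2}+\big(\frac{\mathsf b\mathsf c}{\mathsf a^4\overline{\mathsf a}^2}-\frac{\mathsf e}{\mathsf a^3\overline{\mathsf a}}\big)d\mathsf a+\frac{d\mathsf e}{\mathsf a^2\overline{\mathsf a}}$, $\alpha_4=\frac{d\overline{\mathsf d}}{\mathsf a\overline{\mathsf a}^2}-\frac{\overline{\mathsf c}\,d\mathsf b}{\mathsf a^2\overline{\mathsf a}^3}+\big(\frac{\mathsf b\overline{\mathsf c}}{\mathsf a^3\overline{\mathsf a}^3}-\frac{\overline{\mathsf d}}{\mathsf a^2\overline{\mathsf a}^2}\big)d\mathsf a$, $\alpha_5=\frac{d\mathsf b}{\mathsf a\overline{\mathsf a}}-\frac{\mathsf b\,d\mathsf a}{\mathsf a^2\overline{\mathsf a}}$. The torsion coefficients $U_i,V_j,W_k$ are the uniquely determined functions on $M\times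 G$ in the structure equations $$d\sigma=(2\alpha_1+\overline\alpha_1)\wedge\sigma+U_1\sigma\wedge\overline\sigma+U_2\sigma\wedge\rho+U_3\sigma\wedge\zeta+U_4\sigma\wedge\overline\zeta+U_5\overline\sigma\wedge\rho+U_6\overline\sigma\wedge\zeta+U_7\overline\sigma\wedge\overline\zeta+\rho\wedge\zeta,$$ $$d\rho=\alpha_2\wedge\sigma+\overline\alpha_2\wedge\overline\sigma+(\alpha_1+\overline\alpha_1)\wedge\rho+V_1\sigma\wedge\overline\sigma+V_2\sigma\wedge\rho+V_3\sigma\wedge\zeta+V_4\sigma\wedge\overline\zeta+\overline V_2\overline\sigma\wedge\rho+\overline V_4\overline\sigma\wedge\zeta+\overline V_3\overline\sigma\wedge\overline\zeta+V_8\rho\wedge\zeta+\overline V_8\rho\wedge\overline\zeta+i\zeta\wedge\overline\zeta,$$ $$d\zeta=\alpha_3\wedge\sigma+\alpha_4\wedge\overline\sigma+\alpha_5\wedge\rho+\alpha_1\wedge\zeta+W_1\sigma\wedge\overline\sigma+W_2\sigma\wedge\rho+W_3\sigma\wedge\zeta+W_4\sigma\wedge\overline\zeta+W_5\overline\sigma\wedge\rho+W_6\overline\sigma\wedge\zeta+W_7\overline\sigma\wedge\overline\zeta+W_8\rho\wedge\zeta+W_9\rho\wedge\overline\zeta+W_{10}\zeta\wedge\overline\zeta.$$ A linear combination of torsion coefficients (and conjugates) is essential if it is unchanged when each $\alpha_s$ is replaced by $\alpha_s+p_s\sigma+q_s\overline\sigma+r_s\rho+s_s\zeta+t_s\overline\zeta$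 with arbitrary functions $p_s,q_s,r_s,s_s,t_s$ (and $\overline\alpha_s$ by the conjugate replacement), the torsion coefficients being recomputed accordingly. *)

(* Defs.v *)
From HB Require Import structures.
From mathcomp Require Import all_boot all_order all_algebra.
From mathcomp Require Import all_classical all_reals all_analysis.
From mathcomp Require Import complex.
Set Implicit Arguments.
Unset Strict Implicit.
Unset Printing Implicit Defensive.
Import Order.TTheory GRing.Theory Num.Theory.
Import numFieldNormedType.Exports.
Local Open Scope classical_set_scope.
Local Open Scope ring_scope.

Section Calculus.
Variables (K : realType) (n : nat).
Notation E := 'rV[K]_n.+1.
Notation C := K[i].
Implicit Types (D : set E) (f : E -> K) (h : E -> C).

Definition rpartial (k : 'I_n.+1) f : E -> K :=
  fun x => 'D_(delta_mx 0 k) f x.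

Definition rpartials (s : seq 'I_n.+1) f : E -> K := foldr rpartial f s.

Definition smooth D f : Prop :=
  forall (s : seq 'I_n.+1) (x : E), D x ->
    {for x, continuous (rpartials s f)} /\
    (forall k, derivable (rpartials s f) x (delta_mx 0 k)).

(* The terms of total degree m of the Taylor series: summing over m-tuples of
   indices with the factor 1/m! is the same as summing
   (d^alpha f)(x) v^alpha / alpha! over the multi-indices of length m. *)
Definition taylor_term f (x v : E) (m : nat) : K :=
  (m`!%:R)^-1 * \sum_(t : m.-tuple 'I_n.+1)
                   rpartials t f x * \prod_(k <- t) v 0 k.

Definition taylor_abs_term f (x v : E) (m : nat) : K :=
  (m`!%:R)^-1 * \sum_(t : m.-tuple 'I_n.+1)
                   `|rpartials t f x * \prod_(k <- t) v 0 k|.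

Definition real_analytic D f : Prop :=
  smooth D f /\
  forall x, D x -> \forall v \near (0 : E),
    cvgn (series (taylor_abs_term f x v)) /\
    series (taylor_term f x v) @ \oo --> f (x + v).

Definition partial (k : 'I_n.+1) h : E -> C :=
  fun x => Complex (rpartial k (fun y => complex.Re (h y)) x)
                   (rpartial k (fun y => complex.Im (h y)) x).

Definition conj_row (v : 'rV[C]_n.+1) : 'rV[C]_n.+1 :=
  map_mx (fun z : C => z^*) v.

(* A complex vector field, and a complex 1-form, are given by their
   coefficients on the coordinate fields, resp. on the coordinate
   differentials; a 2-form by its values on pairs of coordinate fields. *)

Definition vapply (X : 'rV[C]_n.+1) h (x : E) : C :=
  \sum_k X 0 k * partial k h x.

Definition bracket (X Y : E -> 'rV[C]_n.+1) : E -> 'rV[C]_n.+1 :=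
  fun x => \row_k (vapply (X x) (fun y => Y y 0 k) x
                   - vapply (Y x) (fun y => X y 0 k) x).

Definition wedge (a b : 'rV[C]_n.+1) : 'M[C]_n.+1 :=
  \matrix_(i, j) (a 0 i * b 0 j - a 0 j * b 0 i).

Definition dfun h : E -> 'rV[C]_n.+1 := fun x => \row_k partial k h x.

Definition dform (w : E -> 'rV[C]_n.+1) : E -> 'M[C]_n.+1 :=
  fun x => \matrix_(i, j) (partial i (fun y => w y 0 j) x
                           - partial j (fun y => w y 0 i) x).

End Calculus.

Section CR.
Variable K : realType.
Notation C := K[i].
Notation E := 'rV[K]_5.
Notation vfield := (E -> 'rV[C]_5).

(* The graph v_j = phi_j(x, y, u_1, u_2, u_3) is parametrised by
   (x, y, u_1, u_2, u_3), numbered 0, ..., 4.  These are the ambient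
   holomorphic coordinates restricted to it. *)
Definition coord_z (p : E) : C := Complex (p 0 (inord 0)) (p 0 (inord 1)).
Definition coord_w (phi : 'I_3 -> E -> K) (j : 'I_3) (p : E) : C :=
  Complex (p 0 (inord (2 + j))) (phi j p).

(* X in C (x) T_p M is of type (0,1) in C^4 iff it annihilates z, w_1, w_2, w_3. *)
Definition T01 (phi : 'I_3 -> E -> K) (p : E) (X : 'rV[C]_5) : Prop :=
  vapply X coord_z p = 0 /\ forall j, vapply X (coord_w phi j) p = 0.

(* The d/dx and d/dy coefficients of d/dzbar. *)
Definition intrinsic_form (X : 'rV[C]_5) : Prop :=
  X 0 (inord 0) = 2^-1 /\ X 0 (inord 1) = 'i / 2.

Definition T01_generator (Om : set E) (phi : 'I_3 -> E -> K) (Lb : vfield) :=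
  forall p, Om p ->
    forall X, (T01 phi p X /\ intrinsic_form X) <-> X = Lb p.

Section Frame.
Variable Lb : vfield.

Definition fL : vfield := fun p => conj_row (Lb p).
Definition fT : vfield := fun p => 'i *: bracket fL Lb p.
Definition fS : vfield := bracket fL fT.
Definition fSb : vfield := bracket Lb fT.

Definition frame (p : E) : 'M[C]_5 :=
  \matrix_(i < 5) nth 0 [:: fSb p; fS p; fT p; Lb p; fL p] i.

Definition maximally_minimal (Om : set E) : Prop :=
  forall p, Om p -> frame p \in unitmx.

(* The columns of the inverse of [frame] are the coefficients of the dual
   coframe. *)
Definition dual_form (i : nat) : vfield :=
  fun p => (col (inord i) (invmx (frame p)))^T.

Definition sigmab0 := dual_form 0.
Definition sigma0 := dual_form 1.
Definition rho0 := dual_form 2.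
Definition zetab0 := dual_form 3.
Definition zeta0 := dual_form 4.

Definition bracket_relations (Om : set E) (P Q R A B E' F G : E -> C) : Prop :=
  forall p, Om p ->
  [/\ bracket fL fS p = P p *: fT p + Q p *: fS p + R p *: fSb p,
      bracket Lb fS p = A p *: fT p + B p *: fS p + (B p)^* *: fSb p,
      bracket fL fSb p = A p *: fT p + B p *: fS p + (B p)^* *: fSb p
    & bracket fT fS p = E' p *: fT p + F p *: fS p + G p *: fSb p].

(* M x G sits in R^5 x C^5, the parameters a, b, c, d, e being numbered
   0, ..., 4; real parts come first, then imaginary parts. *)
Notation MG := 'rV[K]_(5 + (5 + 5)).
Notation form1 := (MG -> 'rV[C]_(5 + (5 + 5))).

Definition base (x : MG) : E := lsubmx x.
Definition param (k : nat) (x : MG) : C :=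
  Complex (x 0 (rshift 5 (lshift 5 (inord k))))
          (x 0 (rshift 5 (rshift 5 (inord k)))).

Definition ga := param 0.
Definition gb := param 1.
Definition gc := param 2.
Definition gd := param 3.
Definition ge := param 4.

Definition total_space (Om : set E) : set MG :=
  [set x | Om (base x) /\ ga x != 0].

Definition pullback (w : vfield) : form1 := fun x => row_mx (w (base x)) 0.

Definition sigma : form1 := fun x =>
  (ga x ^+ 2 * (ga x)^*) *: pullback sigma0 x.
Definition rho : form1 := fun x =>
  (gc x)^* *: pullback sigmab0 x + gc x *: pullback sigma0 x
  + (ga x * (ga x)^*) *: pullback rho0 x.
Definition zeta : form1 := fun x =>
  (gd x)^* *: pullback sigmab0 x + ge x *: pullback sigma0 x
  + gb x *: pullback rho0 x + ga x *: pullback zeta0 x.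
Definition sigmab : form1 := fun x => conj_row (sigma x).
Definition zetab : form1 := fun x => conj_row (zeta x).

Inductive mc_index := mc1 | mc2 | mc3 | mc4 | mc5.

Definition maurer_cartan (k : mc_index) : form1 := fun x =>
  let a := ga x in let b := gb x in let c := gc x in
  let d := gd x in let e := ge x in
  let da := dfun ga x in let dab := dfun (fun y => (ga y)^*) x in
  let db := dfun gb x in let dc := dfun gc x in
  let ddb := dfun (fun y => (gd y)^*) x in let de := dfun ge x in
  match k with
  | mc1 => a^-1 *: da
  | mc2 => (a ^+ 2 * a^*)^-1 *: dc - (c / (a ^+ 3 * a^*)) *: da
           - (c / (a ^+ 2 * a^* ^+ 2)) *: dab
  | mc3 => - (c / (a ^+ 3 * a^* ^+ 2)) *: db
           + (b * c / (a ^+ 4 * a^* ^+ 2) - e / (a ^+ 3 * a^*)) *: da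
           + (a ^+ 2 * a^*)^-1 *: de
  | mc4 => (a * a^* ^+ 2)^-1 *: ddb - (c^* / (a ^+ 2 * a^* ^+ 3)) *: db
           + (b * c^* / (a ^+ 3 * a^* ^+ 3) - d^* / (a ^+ 2 * a^* ^+ 2)) *: da
  | mc5 => (a * a^*)^-1 *: db - (b / (a ^+ 2 * a^*)) *: da
  end.

Inductive torsion_index :=
  | U1 | U2 | U3 | U4 | U5 | U6 | U7
  | V1 | V2 | V3 | V4 | V8
  | W1 | W2 | W3 | W4 | W5 | W6 | W7 | W8 | W9 | W10.

Definition torsion_indices : seq torsion_index :=
  [:: U1; U2; U3; U4; U5; U6; U7; V1; V2; V3; V4; V8;
      W1; W2; W3; W4; W5; W6; W7; W8; W9; W10].

Notation torsion := (torsion_index -> MG -> C).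

Definition structure_equations (Om : set E) (alpha : mc_index -> form1)
    (tau : torsion) : Prop :=
  forall x, total_space Om x ->
  let s := sigma x in let sb := sigmab x in let r := rho x in
  let z := zeta x in let zb := zetab x in
  let al k := alpha k x in let alb k := conj_row (alpha k x) in
  let t k := tau k x in
  [/\ dform sigma x =
        wedge (2 *: al mc1 + alb mc1) s
        + t U1 *: wedge s sb + t U2 *: wedge s r + t U3 *: wedge s z
        + t U4 *: wedge s zb + t U5 *: wedge sb r + t U6 *: wedge sb z
        + t U7 *: wedge sb zb + wedge r z,
      dform rho x =
        wedge (al mc2) s + wedge (alb mc2) sb + wedge (al mc1 + alb mc1) r
        + t V1 *: wedge s sb + t V2 *: wedge s r + t V3 *: wedge s z
        + t V4 *: wedge s zb + (t V2)^* *: wedge sb r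
        + (t V4)^* *: wedge sb z + (t V3)^* *: wedge sb zb
        + t V8 *: wedge r z + (t V8)^* *: wedge r zb + 'i *: wedge z zb
    & dform zeta x =
        wedge (al mc3) s + wedge (al mc4) sb + wedge (al mc5) r
        + wedge (al mc1) z
        + t W1 *: wedge s sb + t W2 *: wedge s r + t W3 *: wedge s z
        + t W4 *: wedge s zb + t W5 *: wedge sb r + t W6 *: wedge sb z
        + t W7 *: wedge sb zb + t W8 *: wedge r z + t W9 *: wedge r zb
        + t W10 *: wedge z zb].

Definition is_torsion (Om : set E) (tau : torsion) : Prop :=
  structure_equations Om maurer_cartan tau.

Definition modified_mc (p q r s t : mc_index -> MG -> C) (k : mc_index) :
    form1 := fun x =>
  maurer_cartan k x + p k x *: sigma x + q k x *: sigmab x + r k x *: rho x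
  + s k x *: zeta x + t k x *: zetab x.

Definition linear_combination (lam mu : torsion_index -> C) (tau : torsion)
    (x : MG) : C :=
  \sum_(k <- torsion_indices) (lam k * tau k x + mu k * (tau k x)^*).

Definition essential (Om : set E) (f : torsion -> MG -> C) : Prop :=
  forall (p q r s t : mc_index -> MG -> C) (tau tau' : torsion),
    is_torsion Om tau ->
    structure_equations Om (modified_mc p q r s t) tau' ->
    forall x, total_space Om x -> f tau' x = f tau x.

Definition five_combinations (tau : torsion) (x : MG) : seq C :=
  [:: tau U5 x;
      tau U6 x;
      tau U7 x;
      tau U3 x + (tau U4 x)^* - 3 * tau V8 x;
      (tau U4 x)^* - tau V8 x - (tau W10 x)^*].

End Frame.
End CR.

(* Main.v *)
(** The torsion coefficients of the lifted coframe are the values of the basic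
    2-forms  d(omega) - (Maurer-Cartan part)  on the fields dual to the lifted
    coframe.  These 2-forms are combinations of d sigma_0, d rho_0, d zeta_0,
    whose values on the initial frame are read off the brackets through
    d omega (X, Y) = - omega ([X, Y]), valid since the omega (X) are constant.
    Smoothness of the frame, needed for this formula, comes from solving the
    linear system that characterizes the (0,1) generator of intrinsic form.

    Replacing alpha_s by alpha_s + p sigma + q sigmab + l rho + h zeta + t zetab
    translates the torsion by an explicit real-linear expression in p, q, l, h, t.
    A combination is essential exactly when it kills this translation; testing
    one parameter at a time leaves the five announced combinations and their
    conjugates, together with V1 + V1^*, which vanishes because rho is real. *)
Require Import Defs.
From HB Require Import structures.
From mathcomp Require Import all_boot all_order all_algebra.
From mathcomp Require Import all_classical all_reals all_analysis.
From mathcomp Require Import complex.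
From mathcomp Require Import ring.
Set Implicit Arguments.
Unset Strict Implicit.
Unset Printing Implicit Defensive.
Import Order.TTheory GRing.Theory Num.Theory.
Import numFieldNormedType.Exports.
Local Open Scope classical_set_scope.
Local Open Scope ring_scope.

(** * Partial derivatives of complex-valued functions *)

(** The 2-forms that remain are basic because the [maurer_cartan] forms are the entries of [dg g^-1]
    for the matrix group that defines the lift: every Leibniz term carrying the differential of a
    parameter is absorbed by them. All torsion can therefore be computed at one point of [M] with
    frozen parameters, and the record [adapted_frame] separates that algebra from the calculus. Two
    difficulties shape the rest. The generator [Lb] is known only through a pointwise
    characterization, so even its differentiability has to be derived. And conjugation makes the
    problem real-linear rather than complex-linear: a complex parameter and its conjugate occur
    together, so testing one parameter yields two equations, one for the coefficients multiplying
    [w] and one for those multiplying its conjugate. *)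

Section ComplexPartial.
Variables (K : realType) (n : nat).
Notation E := 'rV[K]_n.+1.
Notation C := K[i].
Implicit Types (D : set E) (h g : E -> C) (k : 'I_n.+1).

Definition is_partial h (x : E) k (d : C) : Prop :=
  is_derive x (delta_mx 0 k) (fun y => complex.Re (h y)) (complex.Re d) /\
  is_derive x (delta_mx 0 k) (fun y => complex.Im (h y)) (complex.Im d).

Definition has_partial h x k := is_partial h x k (partial k h x).

Lemma is_partialE h x k d : is_partial h x k d -> partial k h x = d.
Proof.
by case: d => a b [/= h1 h2]; rewrite /partial /rpartial !derive_val.
Qed.

Lemma is_partialP h x k d : is_partial h x k d -> has_partial h x k.
Proof. by move=> H; rewrite /has_partial (is_partialE H). Qed.

Lemma has_partialP h x k :
  derivable (fun y => complex.Re (h y)) x (delta_mx 0 k) ->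
  derivable (fun y => complex.Im (h y)) x (delta_mx 0 k) -> has_partial h x k.
Proof. by move=> h1 h2; split; apply: DeriveDef. Qed.

Lemma is_partial_cst c x k : is_partial (fun=> c) x k 0.
Proof. by split; apply: is_derive_cst. Qed.

Lemma is_derive_ext (f f' : E -> K) x v (d d' : K) :
  is_derive x v f d -> f =1 f' -> d = d' -> is_derive x v f' d'.
Proof. by move=> H /funext <- <-. Qed.

Lemma derivable_ext (f f' : E -> K) x v :
  derivable f x v -> f =1 f' -> derivable f' x v.
Proof. by move=> H /funext <-. Qed.

Lemma is_partialD h g x k d e : is_partial h x k d -> is_partial g x k e ->
  is_partial (fun y => h y + g y) x k (d + e).
Proof.
move=> [h1 h2] [g1 g2]; split.
- apply: is_derive_ext (is_deriveD h1 g1) _ _ => [y|].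
    by rewrite fctE; case: (h y); case: (g y).
  by case: d e {h1 h2 g1 g2} => ? ? [].
- apply: is_derive_ext (is_deriveD h2 g2) _ _ => [y|].
    by rewrite fctE; case: (h y); case: (g y).
  by case: d e {h1 h2 g1 g2} => ? ? [].
Qed.

Lemma is_partialN h x k d : is_partial h x k d ->
  is_partial (fun y => - h y) x k (- d).
Proof.
move=> [h1 h2]; split.
- apply: is_derive_ext (is_deriveN h1) _ _ => [y|].
    by rewrite fctE; case: (h y).
  by case: d {h1 h2}.
- apply: is_derive_ext (is_deriveN h2) _ _ => [y|].
    by rewrite fctE; case: (h y).
  by case: d {h1 h2}.
Qed.

Lemma is_partialM h g x k d e : is_partial h x k d -> is_partial g x k e ->
  is_partial (fun y => h y * g y) x k (d * g x + h x * e).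
Proof.
move=> [h1 h2] [g1 g2]; split.
- apply: is_derive_ext (is_deriveB (is_deriveM h1 g1) (is_deriveM h2 g2)) _ _
    => [y|]; first by rewrite !fctE; case: (h y); case: (g y).
  rewrite /GRing.scale /=; case: (h x); case: (g x); case: d e {h1 h2 g1 g2}.
  by move=> ? ? [] * /=; ring.
- apply: is_derive_ext (is_deriveD (is_deriveM h1 g2) (is_deriveM h2 g1)) _ _
    => [y|]; first by rewrite !fctE; case: (h y); case: (g y).
  rewrite /GRing.scale /=; case: (h x); case: (g x); case: d e {h1 h2 g1 g2}.
  by move=> ? ? [] * /=; ring.
Qed.

Lemma is_partial_conj h x k d : is_partial h x k d ->
  is_partial (fun y => (h y)^*) x k d^*.
Proof.
move=> [h1 h2]; split.
- by apply: is_derive_ext h1 _ _ => [y|]; [case: (h y)|case: d {h2}].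
- apply: is_derive_ext (is_deriveN h2) _ _ => [y|].
    by rewrite fctE; case: (h y).
  by case: d {h1 h2}.
Qed.

Lemma is_partial_sum I (r : seq I) (F : I -> E -> C) (G : I -> C) x k :
  (forall i, is_partial (F i) x k (G i)) ->
  is_partial (fun y => \sum_(i <- r) F i y) x k (\sum_(i <- r) G i).
Proof.
move=> H; elim: r => [|i r IH].
  rewrite big_nil (_ : (fun _ => _) = fun=> 0); first exact: is_partial_cst.
  by apply/funext => y; rewrite big_nil.
rewrite big_cons (_ : (fun _ => _) = fun y => F i y + \sum_(i <- r) F i y).
  exact: is_partialD.
by apply/funext => y; rewrite big_cons.
Qed.

(** The inverse is the conjugate of [h] divided by its squared modulus [N], which reduces the claim
    to inverting a real function that does not vanish at [x]. *)
Lemma has_partialV h x k : h x != 0 -> has_partial h x k ->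
  has_partial (fun y => (h y)^-1) x k.
Proof.
move=> hx0 Hh.
have [N1 _] := is_partialM Hh (is_partial_conj Hh).
pose N y := complex.Re (h y * (h y)^*).
have N0 : N x != 0.
  move: hx0; rewrite /N; case: (h x) => u v /=; rewrite eq_complex /= mulrN opprK.
  by rewrite -!expr2 paddr_eq0 ?sqr_ge0// !sqrf_eq0.
have DN : derivable (fun y => (N y)^-1) x (delta_mx 0 k).
  by apply: derivableV => //; case: N1.
have [[d1 _] [d2 _]] := Hh.
apply: has_partialP.
- apply: derivable_ext (derivableM d1 DN) _ => y.
  by rewrite /N fctE; case: (h y) => u v /=; rewrite mulrN opprK -!expr2.
- apply: derivable_ext (derivableN (derivableM d2 DN)) _ => y.
  by rewrite /N !fctE; case: (h y) => u v /=; rewrite mulrN opprK -!expr2.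
Qed.

Lemma partial_near h g x k : (\near x, h x = g x) -> partial k h x = partial k g x.
Proof.
move=> hg; rewrite /partial /rpartial; congr Complex; apply: near_eq_derive;
  by apply: filterS hg => y ->.
Qed.

Lemma has_partial_near h g x k : (\near x, h x = g x) ->
  has_partial h x k -> has_partial g x k.
Proof.
move=> hg [h1 h2]; apply: has_partialP.
- case: h1 => H _; apply: near_eq_derivable H.
  by apply: filterS hg => y ->.
- case: h2 => H _; apply: near_eq_derivable H.
  by apply: filterS hg => y ->.
Qed.

End ComplexPartial.

(** * Iterated differentiability on an open set, and Lie brackets *)

Section Smooth.
Variables (K : realType) (n : nat) (D : set 'rV[K]_n.+1).
Hypothesis Dopen : open D.
Notation E := 'rV[K]_n.+1.
Notation C := K[i].
Implicit Types (h g : E -> C) (k : 'I_n.+1).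

Lemma open_near h g x : (forall y, D y -> h y = g y) -> D x ->
  \near x, h x = g x.
Proof. by move=> hg Dx; apply: filterS hg _; apply: open_nbhs_nbhs. Qed.

Lemma open_partial h g k x : (forall y, D y -> h y = g y) -> D x ->
  partial k h x = partial k g x.
Proof. by move=> hg Dx; apply/partial_near/open_near. Qed.

(* Continuity is not required: differentiation along the coordinate directions
   already satisfies the sum, product and inverse rules. *)
Fixpoint cdiff m h : Prop :=
  if m is m'.+1 then
    forall k, (forall x, D x -> has_partial h x k) /\ cdiff m' (partial k h)
  else True.

Lemma cdiff_eq m h g : (forall y, D y -> h y = g y) -> cdiff m h -> cdiff m g.
Proof.
elim: m h g => //= m IH h g hg H k; have [H1 H2] := H k; split.
  by move=> x Dx; apply: has_partial_near (H1 x Dx); apply: open_near.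
by apply: IH H2 => y; apply: open_partial.
Qed.

Lemma cdiffW m h : cdiff m.+1 h -> cdiff m h.
Proof.
elim: m h => // m IH h H k; have [H1 H2] := H k; split => //.
exact: IH.
Qed.

Lemma cdiff_cst m c : cdiff m (fun=> c).
Proof.
elim: m c => //= m IH c k; split=> [x Dx|].
  exact: is_partialP (is_partial_cst _ _ _).
apply: cdiff_eq (IH 0) => y _.
by rewrite (is_partialE (is_partial_cst _ _ _)).
Qed.

Lemma cdiffD m h g : cdiff m h -> cdiff m g -> cdiff m (fun y => h y + g y).
Proof.
elim: m h g => //= m IH h g Hh Hg k.
have [h1 h2] := Hh k; have [g1 g2] := Hg k; split=> [x Dx|].
  exact: is_partialP (is_partialD (h1 _ Dx) (g1 _ Dx)).
apply: cdiff_eq (IH _ _ h2 g2) => y Dy.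
by rewrite (is_partialE (is_partialD (h1 _ Dy) (g1 _ Dy))).
Qed.

Lemma cdiffN m h : cdiff m h -> cdiff m (fun y => - h y).
Proof.
elim: m h => //= m IH h Hh k; have [h1 h2] := Hh k; split=> [x Dx|].
  exact: is_partialP (is_partialN (h1 _ Dx)).
apply: cdiff_eq (IH _ h2) => y Dy.
by rewrite (is_partialE (is_partialN (h1 _ Dy))).
Qed.

Lemma cdiff_conj m h : cdiff m h -> cdiff m (fun y => (h y)^*).
Proof.
elim: m h => //= m IH h Hh k; have [h1 h2] := Hh k; split=> [x Dx|].
  exact: is_partialP (is_partial_conj (h1 _ Dx)).
apply: cdiff_eq (IH _ h2) => y Dy.
by rewrite (is_partialE (is_partial_conj (h1 _ Dy))).
Qed.

Lemma cdiffM m h g : cdiff m h -> cdiff m g -> cdiff m (fun y => h y * g y).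
Proof.
elim: m h g => // m IH h g Hh Hg k.
have [h1 h2] := Hh k; have [g1 g2] := Hg k; split=> [x Dx|].
  exact: is_partialP (is_partialM (h1 _ Dx) (g1 _ Dx)).
apply: cdiff_eq (cdiffD (IH _ _ h2 (cdiffW Hg)) (IH _ _ (cdiffW Hh) g2)) => y Dy.
by rewrite (is_partialE (is_partialM (h1 _ Dy) (g1 _ Dy))).
Qed.

(** The partial derivative of the inverse is [- h' * (h^-1 * h^-1)], so the induction hypothesis
    applies to both inverse factors with one order less. *)
Lemma cdiffV m h : (forall x, D x -> h x != 0) -> cdiff m h ->
  cdiff m (fun y => (h y)^-1).
Proof.
move=> h0; elim: m => // m IH Hh k.
have [h1 h2] := Hh k; split=> [x Dx|].
  by apply: has_partialV; [exact: h0|exact: h1].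
have HV := IH (cdiffW Hh).
apply: cdiff_eq (cdiffN (cdiffM h2 (cdiffM HV HV))) => y Dy.
have Hp : has_partial (fun y => (h y)^-1) y k.
  by apply: has_partialV; [exact: h0|exact: h1].
(* Differentiate [h * h^-1 = 1] and solve for the derivative of the inverse. The identity holds only
   on [D], whence the appeal to openness. *)
have := is_partialE (is_partialM (h1 _ Dy) Hp).
rewrite (@open_partial _ (fun=> 1) _ _ _ Dy); last by move=> ? /h0; exact: mulfV.
rewrite (is_partialE (is_partial_cst _ _ _)) => /esym/(canRL (addKr _)).
rewrite addr0 => /(canRL (mulKf (h0 _ Dy))) ->.
by rewrite mulrN mulrCA.
Qed.

Lemma cdiff_sum m I (r : seq I) (F : I -> E -> C) :
  (forall i, cdiff m (F i)) -> cdiff m (fun y => \sum_(i <- r) F i y).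
Proof.
move=> H; elim: r => [|i r IH].
  by apply: cdiff_eq (cdiff_cst m 0) => y _; rewrite big_nil.
by apply: cdiff_eq (cdiffD (H i) IH) => y _; rewrite big_cons.
Qed.

Lemma cdiff_prod m I (r : seq I) (F : I -> E -> C) :
  (forall i, cdiff m (F i)) -> cdiff m (fun y => \prod_(i <- r) F i y).
Proof.
move=> H; elim: r => [|i r IH].
  by apply: cdiff_eq (cdiff_cst m 1) => y _; rewrite big_nil.
by apply: cdiff_eq (cdiffM (H i) IH) => y _; rewrite big_cons.
Qed.

Lemma cdiff_partial m h k : cdiff m.+1 h -> cdiff m (partial k h).
Proof. by move=> /(_ k)[]. Qed.

Lemma cdiff_has_partial m h x k : cdiff m.+1 h -> D x -> has_partial h x k.
Proof. by move=> /(_ k)[H _]; exact: H. Qed.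

Lemma cdiff_det m p (A : E -> 'M[C]_p) :
  (forall i j, cdiff m (fun y => A y i j)) -> cdiff m (fun y => \det (A y)).
Proof.
move=> H; apply: cdiff_sum => s; apply: cdiffM; first exact: cdiff_cst.
exact: cdiff_prod.
Qed.

Lemma cdiff_invmx m p (A : E -> 'M[C]_p) :
  (forall x, D x -> A x \in unitmx) ->
  (forall i j, cdiff m (fun y => A y i j)) ->
  forall i j, cdiff m (fun y => invmx (A y) i j).
Proof.
move=> A0 HA i j.
(* The adjugate formula; it describes [invmx] on [D], where [A] is invertible and [invmx] does not
   take its default value. *)
apply: (@cdiff_eq _ (fun y => (\det (A y))^-1 * (cofactor (A y) j i))).
  by move=> y Dy; rewrite /invmx A0 // !mxE.
apply: cdiffM; first apply: cdiffV.
- by move=> x /A0; rewrite unitmxE unitfE.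
- exact: cdiff_det.
apply: cdiffM; first exact: cdiff_cst.
apply: cdiff_det => u v; apply: cdiff_eq (HA (lift j u) (lift i v)) => y _.
by rewrite !mxE.
Qed.

(** The sequence [s] is quantified before [m] because each further partial derivative lengthens
    it. *)
Lemma smooth_cdiff (f : E -> K) : smooth D f ->
  forall s m, cdiff m (fun y => Complex (rpartials s f y) 0).
Proof.
move=> Hf s m; elim: m s => // m IH s k.
have Hp x : D x -> is_partial (fun y => Complex (rpartials s f y) 0) x k
    (Complex (rpartials (k :: s) f x) 0).
  move=> Dx; split => /=; last exact: is_derive_cst.
  by apply: DeriveDef => //; have [_] := Hf s x Dx.
split=> [x /Hp/is_partialP//|].
by apply: cdiff_eq (IH (k :: s)) => y /Hp/is_partialE ->.
Qed.

(** All orders at once: every bracket loses one derivative, and the frame contains brackets of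
    brackets. *)
Definition smooth_row (X : E -> 'rV[C]_n.+1) := forall m k, cdiff m (fun y => X y 0 k).

Lemma cdiff_vapply m (X : E -> 'rV[C]_n.+1) h : smooth_row X -> cdiff m.+1 h ->
  cdiff m (fun y => vapply (X y) h y).
Proof.
move=> HX Hh; apply: cdiff_sum => k; apply: cdiffM; first exact: HX.
exact: cdiff_partial.
Qed.

Lemma smooth_bracket X Y : smooth_row X -> smooth_row Y -> smooth_row (bracket X Y).
Proof.
move=> HX HY m k.
apply: (@cdiff_eq _ (fun y => vapply (X y) (fun y => Y y 0 k) y
                   - vapply (Y y) (fun y => X y 0 k) y)).
  by move=> y _; rewrite mxE.
by apply: cdiffD; [|apply: cdiffN]; apply: cdiff_vapply.
Qed.

Lemma smooth_conj X : smooth_row X -> smooth_row (fun x => conj_row (X x)).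
Proof.
by move=> HX m k; apply: cdiff_eq (cdiff_conj (HX m k)) => y _; rewrite !mxE.
Qed.

Lemma smooth_scale c X : smooth_row X -> smooth_row (fun x => c *: X x).
Proof.
move=> HX m k; apply: cdiff_eq (cdiffM (cdiff_cst m c) (HX m k)) => y _.
by rewrite !mxE.
Qed.

Lemma bracket_eq X X' Y Y' : (forall x, D x -> X x = X' x) ->
  (forall x, D x -> Y x = Y' x) -> forall x, D x -> bracket X Y x = bracket X' Y' x.
Proof.
move=> HX HY x Dx; apply/rowP => k; rewrite [LHS]mxE [RHS]mxE (HX x Dx) (HY x Dx).
congr (_ - _); apply: eq_bigr => l _; apply: (congr1 ( *%R _)).
  by apply: open_partial => // y Dy; rewrite (HY y Dy).
by apply: open_partial => // y Dy; rewrite (HX y Dy).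
Qed.

(** The coordinate fields are real, so conjugation commutes with their derivatives. *)
Lemma conj_bracket X Y : smooth_row X -> smooth_row Y -> forall x, D x ->
  conj_row (bracket X Y x) = bracket (fun y => conj_row (X y)) (fun y => conj_row (Y y)) x.
Proof.
have vc (Z : 'rV[C]_n.+1) T k x : smooth_row T -> D x ->
    (vapply Z (fun y => T y 0 k) x)^* =
    vapply (conj_row Z) (fun y => conj_row (T y) 0 k) x.
  move=> HT Dx; rewrite rmorph_sum; apply: eq_bigr => l _.
  rewrite rmorphM !mxE; congr (_ * _); apply/esym.
  rewrite (_ : (fun _ => _) = fun y => (T y 0 k)^*); last first.
    by apply/funext => y; rewrite mxE.
  exact: is_partialE (is_partial_conj (cdiff_has_partial _ (HT 1%N k) Dx)).
by move=> HX HY x Dx; apply/rowP => k; rewrite !mxE rmorphB /= !vc.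
Qed.

Lemma bracketC X Y (x : E) : bracket X Y x = - bracket Y X x.
Proof. by apply/rowP => k; rewrite !mxE opprB. Qed.

End Smooth.

(** * Exterior calculus *)

Section Forms.
Variables (K : realType) (n : nat).
Notation E := 'rV[K]_n.+1.
Notation C := K[i].
Notation V := 'rV[C]_n.+1.
Implicit Types (D : set E) (h g : E -> C) (k : 'I_n.+1).

Definition pairing (w X : V) : C := \sum_j w 0 j * X 0 j.
Definition feval (Om : 'M[C]_n.+1) (X Y : V) : C :=
  \sum_i \sum_j X 0 i * Om i j * Y 0 j.

(** The matrix form, from which the linearity rules below are inherited; [fevalE] plays the same
    role for 2-forms. *)
Lemma pairingE w X : pairing w X = (X *m w^T) 0 0.
Proof. by rewrite mxE; apply: eq_bigr => j _; rewrite mxE mulrC. Qed.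

Lemma fevalE Om X Y : feval Om X Y = (X *m Om *m Y^T) 0 0.
Proof.
rewrite mxE /feval exchange_big; apply: eq_bigr => j _.
by rewrite !mxE mulr_suml.
Qed.

Lemma pairingDr w X Y : pairing w (X + Y) = pairing w X + pairing w Y.
Proof. by rewrite !pairingE mulmxDl mxE. Qed.
Lemma pairingZr w c X : pairing w (c *: X) = c * pairing w X.
Proof. by rewrite !pairingE -scalemxAl mxE. Qed.
Lemma pairingNr w X : pairing w (- X) = - pairing w X.
Proof. by rewrite !pairingE mulNmx mxE. Qed.
Lemma pairingDl w w' X : pairing (w + w') X = pairing w X + pairing w' X.
Proof. by rewrite !pairingE linearD mulmxDr mxE. Qed.
Lemma pairingZl w c X : pairing (c *: w) X = c * pairing w X.
Proof. by rewrite !pairingE linearZ /= -scalemxAr mxE. Qed.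

Lemma fevalDl Om X X' Y : feval Om (X + X') Y = feval Om X Y + feval Om X' Y.
Proof. by rewrite !fevalE !mulmxDl mxE. Qed.
Lemma fevalZl Om c X Y : feval Om (c *: X) Y = c * feval Om X Y.
Proof. by rewrite !fevalE -!scalemxAl mxE. Qed.
Lemma fevalDr Om X Y Y' : feval Om X (Y + Y') = feval Om X Y + feval Om X Y'.
Proof. by rewrite !fevalE linearD mulmxDr mxE. Qed.
Lemma fevalZr Om c X Y : feval Om X (c *: Y) = c * feval Om X Y.
Proof. by rewrite !fevalE linearZ /= -!scalemxAr mxE. Qed.
Lemma fevalD Om Om' X Y : feval (Om + Om') X Y = feval Om X Y + feval Om' X Y.
Proof. by rewrite !fevalE mulmxDr mulmxDl mxE. Qed.
Lemma fevalZ Om c X Y : feval (c *: Om) X Y = c * feval Om X Y.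
Proof. by rewrite !fevalE -scalemxAr -scalemxAl mxE. Qed.

Definition antisym (Om : 'M[C]_n.+1) := forall i j, Om i j = - Om j i.

Lemma fevalC Om X Y : antisym Om -> feval Om X Y = - feval Om Y X.
Proof.
move=> H; rewrite /feval exchange_big -sumrN; apply: eq_bigr => i _.
rewrite -sumrN; apply: eq_bigr => j _; rewrite (H j i); ring.
Qed.

Lemma feval_diag Om X : antisym Om -> feval Om X X = 0.
Proof.
move=> /fevalC H; have : feval Om X X *+ 2 == 0 by rewrite mulr2n {2}H subrr.
by rewrite mulrn_eq0 => /eqP.
Qed.

Lemma antisym_dform w x : antisym (dform w x).
Proof. by move=> i j; rewrite !mxE opprB. Qed.

Lemma antisymD Om Om' : antisym Om -> antisym Om' -> antisym (Om + Om').
Proof. by move=> H H' i j; rewrite !mxE H H' opprD. Qed.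

Lemma antisymZ c Om : antisym Om -> antisym (c *: Om).
Proof. by move=> H i j; rewrite !mxE H mulrN. Qed.

Lemma feval_conj Om X Y :
  (feval Om X Y)^* = feval (map_mx (fun z => z^*) Om) (conj_row X) (conj_row Y).
Proof.
rewrite rmorph_sum; apply: eq_bigr => i _; rewrite rmorph_sum.
by apply: eq_bigr => j _; rewrite !rmorphM !mxE.
Qed.

Lemma pairing_conj w X : (pairing w X)^* = pairing (conj_row w) (conj_row X).
Proof. by rewrite rmorph_sum; apply: eq_bigr => i _; rewrite rmorphM !mxE. Qed.

(** The product rule alone gives the formula; no symmetry of second derivatives enters. The
    normalization has no factor 1/2, in agreement with [wedge] and [dform]. *)
Lemma cartan D (w X Y : E -> V) x : open D -> smooth_row D w -> smooth_row D X ->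
  smooth_row D Y -> D x ->
  feval (dform w x) (X x) (Y x) =
  vapply (X x) (fun y => pairing (w y) (Y y)) x
  - vapply (Y x) (fun y => pairing (w y) (X y)) x - pairing (w x) (bracket X Y x).
Proof.
move=> Do Hw HX HY Dx.
have dp (Z : E -> V) k : smooth_row D Z ->
    partial k (fun y => pairing (w y) (Z y)) x =
    \sum_j (partial k (fun y => w y 0 j) x * Z x 0 j
            + w x 0 j * partial k (fun y => Z y 0 j) x).
  move=> HZ; apply: is_partialE; apply: is_partial_sum => j.
  by apply: is_partialM; [apply: cdiff_has_partial (Hw 1%N j) Dx
    |apply: cdiff_has_partial (HZ 1%N j) Dx].
rewrite /vapply (eq_bigr _ (fun k _ => congr1 _ (dp Y k HY))).
rewrite (eq_bigr _ (fun k _ => congr1 (fun z => Y x 0 k * z) (dp X k HX))).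
rewrite /feval /pairing.
(* The left side contains derivatives of [w] only. *)
transitivity (\sum_i \sum_j (X x 0 i * (partial i (fun y => w y 0 j) x * Y x 0 j) )
 - \sum_i \sum_j (Y x 0 i * (partial i (fun y => w y 0 j) x * X x 0 j))).
  rewrite [X in _ - X]exchange_big -sumrB; apply: eq_bigr => i _.
  by rewrite -sumrB; apply: eq_bigr => j _; rewrite !mxE; ring.
(* Add and subtract the terms that differentiate [X] and [Y]: they complete the two product rules,
   and their difference is the pairing with the bracket. *)
transitivity (\sum_i \sum_j (X x 0 i * (partial i (fun y => w y 0 j) x * Y x 0 j
   + w x 0 j * partial i (fun y => Y y 0 j) x))
 - \sum_i \sum_j (Y x 0 i * (partial i (fun y => w y 0 j) x * X x 0 j
   + w x 0 j * partial i (fun y => X y 0 j) x))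
 - \sum_i \sum_j (X x 0 i * (w x 0 j * partial i (fun y => Y y 0 j) x)
     - Y x 0 i * (w x 0 j * partial i (fun y => X y 0 j) x))).
  rewrite -!sumrB; apply: eq_bigr => i _; rewrite -!sumrB.
  by apply: eq_bigr => j _; ring.
congr (_ - _ - _); try by apply: eq_bigr => i _; rewrite mulr_sumr.
rewrite exchange_big; apply: eq_bigr => j _; rewrite mxE /vapply -sumrB mulr_sumr.
by apply: eq_bigr => i _; ring.
Qed.

Lemma cartan_const D (w X Y : E -> V) a b x : open D -> smooth_row D w ->
  smooth_row D X -> smooth_row D Y -> D x ->
  (forall y, D y -> pairing (w y) (X y) = a) ->
  (forall y, D y -> pairing (w y) (Y y) = b) ->
  feval (dform w x) (X x) (Y x) = - pairing (w x) (bracket X Y x).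
Proof.
move=> Do Hw HX HY Dx Ha Hb; rewrite (cartan Do) //.
have v0 Z h c : (forall y, D y -> h y = c) -> vapply Z h x = 0.
  move=> H; apply: big1 => k _; rewrite (open_partial Do _ H Dx).
  by rewrite (is_partialE (is_partial_cst _ _ _)) mulr0.
by rewrite (v0 _ _ _ Ha) (v0 _ _ _ Hb) subr0 add0r.
Qed.

Lemma dform_eq D (w w' : E -> V) x : open D -> (forall y, D y -> w y = w' y) ->
  D x -> dform w x = dform w' x.
Proof.
move=> Do H Dx; apply/matrixP => i j; rewrite !mxE.
by congr (_ - _); apply: (open_partial Do _ _ Dx) => y Dy; rewrite H.
Qed.

Definition has_partials_row (w : E -> V) x :=
  forall k j, has_partial (fun y => w y 0 j) x k.

Lemma dform_conj w x : has_partials_row w x ->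
  dform (fun y => conj_row (w y)) x = map_mx (fun z => z^*) (dform w x).
Proof.
move=> H; apply/matrixP => i j; rewrite !mxE.
have dc k l : partial k (fun y => conj_row (w y) 0 l) x = (partial k (fun y => w y 0 l) x)^*.
  rewrite (_ : (fun y => conj_row (w y) 0 l) = fun y => (w y 0 l)^*).
    exact: is_partialE (is_partial_conj (H _ _)).
  by apply/funext => y; rewrite mxE.
by rewrite !dc rmorphB.
Qed.

Lemma dformD w w' x : has_partials_row w x -> has_partials_row w' x ->
  dform (fun y => w y + w' y) x = dform w x + dform w' x.
Proof.
move=> H H'; apply/matrixP => i j; rewrite !mxE.
have dc k l : partial k (fun y => (w y + w' y) 0 l) x =
    partial k (fun y => w y 0 l) x + partial k (fun y => w' y 0 l) x.
  rewrite (_ : (fun y => (w y + w' y) 0 l) = fun y => w y 0 l + w' y 0 l).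
    exact: is_partialE (is_partialD (H _ _) (H' _ _)).
  by apply/funext => y; rewrite mxE.
by rewrite !dc; ring.
Qed.

Lemma has_partials_rowD w w' x : has_partials_row w x -> has_partials_row w' x ->
  has_partials_row (fun y => w y + w' y) x.
Proof.
move=> H H' k l; rewrite (_ : (fun y => (w y + w' y) 0 l) = fun y => w y 0 l + w' y 0 l).
  exact: is_partialP (is_partialD (H _ _) (H' _ _)).
by apply/funext => y; rewrite mxE.
Qed.

Lemma has_partials_rowZ g w x : (forall k, has_partial g x k) -> has_partials_row w x ->
  has_partials_row (fun y => g y *: w y) x.
Proof.
move=> H H' k l; rewrite (_ : (fun y => (g y *: w y) 0 l) = fun y => g y * w y 0 l).
  exact: is_partialP (is_partialM (H _) (H' _ _)).
by apply/funext => y; rewrite mxE.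
Qed.

Lemma dformZ g w x : (forall k, has_partial g x k) -> has_partials_row w x ->
  dform (fun y => g y *: w y) x = wedge (dfun g x) (w x) + g x *: dform w x.
Proof.
move=> H H'; apply/matrixP => i j; rewrite !mxE.
have dc k l : partial k (fun y => (g y *: w y) 0 l) x =
    partial k g x * w x 0 l + g x * partial k (fun y => w y 0 l) x.
  rewrite (_ : (fun y => (g y *: w y) 0 l) = fun y => g y * w y 0 l).
    exact: is_partialE (is_partialM (H _) (H' _ _)).
  by apply/funext => y; rewrite mxE.
rewrite (dc i j) (dc j i).
(* Stated for free variables so that [ring] meets atoms instead of partial derivatives. *)
have alg (a b c a' b' c' k : C) :
    a * b + k * c - (a' * b' + k * c') = a * b - a' * b' + k * (c - c') by ring.
exact: alg.
Qed.

Lemma dfunM g h x : (forall k, has_partial g x k) -> (forall k, has_partial h x k) ->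
  dfun (fun y => g y * h y) x = h x *: dfun g x + g x *: dfun h x.
Proof.
move=> H H'; apply/rowP => k; rewrite !mxE.
by rewrite (is_partialE (is_partialM (H _) (H' _))) mulrC.
Qed.

Lemma dfun_conj g x : (forall k, has_partial g x k) ->
  dfun (fun y => (g y)^*) x = conj_row (dfun g x).
Proof.
by move=> H; apply/rowP => k; rewrite !mxE (is_partialE (is_partial_conj (H _))).
Qed.

End Forms.

(** * Pullback of forms along the projection of [M x G] to [M] *)

Section Pullback.
Variables (K : realType) (p q : nat).
Notation B := 'rV[K]_p.+1.
Notation E := 'rV[K]_(p.+1 + q).
Notation C := K[i].

(** The projection is linear, so the difference quotients above and below are the same function of
    the increment. *)
Lemma is_derive_lsubmx (f : B -> K) (x v : E) (d : K) :
  is_derive (lsubmx x) (lsubmx v) f d -> is_derive x v (fun y => f (lsubmx y)) d.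
Proof.
have e (a : E) : (fun h : K => h^-1 *: (((fun y => f (lsubmx y)) \o shift a) (h *: v)
      - f (lsubmx a))) =
    (fun h : K => h^-1 *: ((f \o shift (lsubmx a)) (h *: lsubmx v) - f (lsubmx a))).
  apply/funext => h /=; congr (_ *: (f _ - _)).
  by apply/rowP => j; rewrite !mxE.
by move=> [d1 d2]; split; [rewrite /derivable e | rewrite /derive e].
Qed.

Lemma lsubmx_deltal (k : 'I_p.+1) :
  lsubmx (delta_mx 0 (lshift q k) : E) = delta_mx 0 k.
Proof. by apply/rowP => j; rewrite !mxE eq_lshift. Qed.

Lemma lsubmx_deltar (k : 'I_q) : lsubmx (delta_mx 0 (rshift p.+1 k) : E) = 0.
Proof. by apply/rowP => j; rewrite !mxE eq_lrshift. Qed.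

Lemma is_partial_pullbackl (h : B -> C) (x : E) k :
  has_partial h (lsubmx x) k ->
  @is_partial K (p + q) (fun y => h (@lsubmx _ 1 p.+1 q y)) x (lshift q k)
    (partial k h (lsubmx x)).
Proof.
move=> [h1 h2]; split.
  by apply: (@is_derive_lsubmx (fun y => complex.Re (h y))); rewrite lsubmx_deltal.
by apply: (@is_derive_lsubmx (fun y => complex.Im (h y))); rewrite lsubmx_deltal.
Qed.

Lemma is_partial_pullbackr (h : B -> C) (x : E) k :
  @is_partial K (p + q) (fun y => h (@lsubmx _ 1 p.+1 q y)) x (rshift p.+1 k) 0.
Proof.
split.
  apply: (@is_derive_lsubmx (fun y => complex.Re (h y))); rewrite lsubmx_deltar.
  exact: is_derive0.
apply: (@is_derive_lsubmx (fun y => complex.Im (h y))); rewrite lsubmx_deltar.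
exact: is_derive0.
Qed.

Definition pullback2 (Om : 'M[C]_p.+1) : 'M[C]_(p.+1 + q) := block_mx Om 0 0 0.

Lemma has_partials_row_pullback (w : B -> 'rV[C]_p.+1) (x : E) :
  has_partials_row w (lsubmx x) ->
  @has_partials_row K (p + q) (fun y => row_mx (w (@lsubmx _ 1 p.+1 q y)) 0) x.
Proof.
move=> H k j; case: (@split_ordP p.+1 q j) => j' ->; last first.
  rewrite (_ : (fun y => _) = fun=> 0).
    exact: is_partialP (is_partial_cst _ _ _).
  by apply/funext => y /=; rewrite (@row_mxEr _ _ p.+1 q) mxE.
rewrite (_ : (fun y => _) = fun y => w (@lsubmx _ 1 p.+1 q y) 0 j'); last first.
  by apply/funext => y /=; rewrite (@row_mxEl _ _ p.+1 q).
case: (@split_ordP p.+1 q k) => k' ->.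
  exact: is_partialP (is_partial_pullbackl (H k' j')).
exact: is_partialP (is_partial_pullbackr (fun y => w y 0 j') x k').
Qed.

Lemma dform_pullback (w : B -> 'rV[C]_p.+1) (x : E) :
  has_partials_row w (lsubmx x) ->
  @dform K (p + q) (fun y => row_mx (w (@lsubmx _ 1 p.+1 q y)) 0) x =
  pullback2 (dform w (lsubmx x)).
Proof.
move=> H.
have pl (k : 'I_(p + q).+1) j : @partial K (p + q) k
   (fun y => (row_mx (w (@lsubmx _ 1 p.+1 q y)) (0 : 'rV[C]_q)) 0 (lshift q j)) x =
   partial k (fun y => w (@lsubmx _ 1 p.+1 q y) 0 j) x.
  apply: (congr1 (fun h => @partial K (p + q) k h x)); apply/funext => y.
  exact: (@row_mxEl _ _ p.+1 q).
have pr (k : 'I_(p + q).+1) j : @partial K (p + q) k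
   (fun y => (row_mx (w (@lsubmx _ 1 p.+1 q y)) (0 : 'rV[C]_q)) 0 (rshift p.+1 j)) x = 0.
  rewrite (_ : (fun y => _) = fun=> 0).
    exact: is_partialE (is_partial_cst _ _ _).
  by apply/funext => y; rewrite (@row_mxEr _ _ p.+1 q) mxE.
have ll (k j : 'I_p.+1) : @partial K (p + q) (@lshift p.+1 q k) (fun y => w (@lsubmx _ 1 p.+1 q y) 0 j) x =
    partial k (fun y => w y 0 j) (lsubmx x).
  exact: is_partialE (is_partial_pullbackl (H k j)).
have rl (k : 'I_q) (j : 'I_p.+1) : @partial K (p + q) (@rshift p.+1 q k) (fun y => w (@lsubmx _ 1 p.+1 q y) 0 j) x = 0.
  exact: is_partialE (is_partial_pullbackr (fun y => w y 0 j) x k).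
apply/matrixP => i j; rewrite /pullback2.
case: (@split_ordP p.+1 q i) => i' ->; case: (@split_ordP p.+1 q j) => j' ->;
  rewrite ?(@block_mxEul _ p.+1 q p.+1 q, @block_mxEur _ p.+1 q p.+1 q, @block_mxEdl _ p.+1 q p.+1 q, @block_mxEdr _ p.+1 q p.+1 q) !mxE;
  by rewrite ?(pl, pr, ll, rl) ?subr0.
Qed.

End Pullback.

(** * Smoothness of the (0,1) generator *)

Section Coordinates.
Variables (K : realType) (n : nat).
Notation E := 'rV[K]_n.+1.

Lemma is_derive_coord (x v : E) (i : 'I_n.+1) :
  is_derive x v (fun y : E => y 0 i) (v 0 i).
Proof.
have H : derivable (id : E -> E) x v by exact: derivable_id.
apply: DeriveDef; first by have/derivable_mxP := H; apply.
by have := derive_mx H; rewrite derive_id => /(congr1 (fun M : E => M 0 i)); rewrite mxE.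
Qed.

Lemma is_partial_coord (x : E) (i j k : 'I_n.+1) :
  is_partial (fun y => Complex (y 0 i) (y 0 j)) x k
    (Complex (k == i)%:R (k == j)%:R).
Proof.
split => /=.
  by have := is_derive_coord x (delta_mx 0 k) i; rewrite mxE eqxx eq_sym.
by have := is_derive_coord x (delta_mx 0 k) j; rewrite mxE eqxx eq_sym.
Qed.

End Coordinates.

Section CRGraph.
Variables (K : realType) (Om : set 'rV[K]_5) (phi : 'I_3 -> 'rV[K]_5 -> K).
Variable Lb : 'rV[K]_5 -> 'rV[K[i]]_5.
Hypotheses (Om_open : open Om) (phi_smooth : forall j, smooth Om (phi j)).
Hypothesis Lb_generator : T01_generator Om phi Lb.
Notation C := K[i].
Notation E := 'rV[K]_5.

Lemma sum_ord5 (V : nmodType) (F : 'I_5 -> V) :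
  \sum_k F k = F (inord 0) + F (inord 1) + \sum_(j < 3) F (inord (2 + j)).
Proof.
rewrite !big_ord_recl !big_ord0 !addrA !addr0; do 4?[congr (_ + _)];
  by congr F; apply: val_inj; rewrite /= inordK.
Qed.

Lemma ord2_lt5 (i : 'I_3) : (2 + i < 5)%N.
Proof. by rewrite (ltn_add2l 2 i 3). Qed.

(* The u-part X_u of a field annihilates w iff
   X_x graph_row 0 + X_y graph_row 1 + X_u graph_mx = 0. *)
Definition graph_mx (p : E) : 'M[C]_3 :=
  \matrix_(k, j) ((k == j)%:R + 'i * Complex (rpartial (inord (2 + k)) (phi j) p) 0).

Definition graph_row (k : nat) (p : E) : 'rV[C]_3 :=
  \row_j ('i * Complex (rpartial (inord k) (phi j) p) 0).

Definition urow (X : 'rV[C]_5) : 'rV[C]_3 := \row_j X 0 (inord (2 + j)).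

Lemma vapply_w p X j : Om p -> vapply X (coord_w phi j) p =
  (X 0 (inord 0) *: graph_row 0 p + X 0 (inord 1) *: graph_row 1 p
   + urow X *m graph_mx p) 0 j.
Proof.
move=> Op; rewrite /vapply.
have pw k : partial k (coord_w phi j) p =
    (k == inord (2 + j))%:R + 'i * Complex (rpartial k (phi j) p) 0.
  rewrite /partial /= (_ : rpartial k _ p = (k == inord (2 + j))%:R).
    by case: (k == _); rewrite /rpartial /=; apply/eqP; rewrite eq_complex /=; apply/andP; split; apply/eqP; ring.
  have := is_derive_coord p (delta_mx 0 k) (inord (2 + j)).
  by rewrite mxE eqxx eq_sym /rpartial => H; rewrite derive_val.
have i2 (a : nat) (i : 'I_3) : (a < 2)%N -> (inord a == inord (2 + i) :> 'I_5) = false.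
  move=> a2; apply/eqP => /(congr1 val); rewrite /= !inordK ?(leq_trans a2) //.
    by move=> ea; rewrite ea in a2.
  by rewrite ord2_lt5.
have E (a : nat) : (a < 2)%N -> X 0 (inord a) * partial (inord a) (coord_w phi j) p =
    (X 0 (inord a) *: graph_row a p) 0 j.
  by move=> a2; rewrite pw i2 // add0r [RHS]mxE; congr (_ * _); rewrite mxE.
rewrite sum_ord5 !E // [RHS]mxE [X in _ = X + _]mxE; congr (_ + _).
rewrite [RHS]mxE; apply: eq_bigr => l _; rewrite pw.
congr (_ * _); first by rewrite mxE.
rewrite [RHS]mxE; congr (_%:R + _); congr nat_of_bool.
apply/eqP/eqP => [/(congr1 val)|-> //].
by rewrite /= !inordK ?ord2_lt5 //; move=> [] /val_inj.
Qed.

(** The [u] components do not act on [z], and the other two contribute [1/2 + (i/2) * i = 0]. *)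
Lemma vapply_z p X : intrinsic_form X -> vapply X (@coord_z K) p = 0.
Proof.
move=> [x0 x1]; rewrite /vapply.
have pz k := is_partialE (is_partial_coord p (inord 0) (inord 1) k).
rewrite (eq_bigr _ (fun k _ => congr1 _ (pz k))) sum_ord5.
rewrite x0 x1 big1 => [|i _].
  have -> : (inord 0 == inord 1 :> 'I_5) = false by apply/eqP => /(congr1 val); rewrite /= !inordK.
  have -> : (inord 1 == inord 0 :> 'I_5) = false by apply/eqP => /(congr1 val); rewrite /= !inordK.
  have e1 : Complex true%:R false%:R = 1 :> C by [].
  have ei : Complex false%:R true%:R = 'i :> C by [].
  rewrite !eqxx e1 ei addr0.
  have := sqrCi C; rewrite expr2 => ii; by rewrite mulrAC ii mulr1 mulN1r subrr.
have i2 (a : nat) : (a < 2)%N -> (inord (2 + i) == inord a :> 'I_5) = false.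
  move=> a2; apply/eqP => /(congr1 val); rewrite /= !inordK ?(leq_trans a2) //.
    by move=> ea; rewrite -ea in a2.
  by rewrite ord2_lt5.
by rewrite !i2 // mulr0.
Qed.

Lemma Lb_intrinsic p : Om p -> intrinsic_form (Lb p).
Proof. by move=> Op; have [_ /(_ erefl)[]] := Lb_generator Op (Lb p). Qed.

Lemma Lb_eq p : Om p -> 2^-1 *: graph_row 0 p + ('i / 2) *: graph_row 1 p
   + urow (Lb p) *m graph_mx p = 0.
Proof.
move=> Op; have [_ /(_ erefl)[[_ H] [h0 h1]]] := Lb_generator Op (Lb p).
by apply/rowP => j; rewrite -h1 -h0 -(vapply_w _ _ Op) H [RHS]mxE.
Qed.

(** Adding a kernel vector to the [u] part of [Lb p] yields another (0,1) vector of intrinsic form,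
    so uniqueness of the generator forces the kernel to be zero at every point of [Om]. *)
Lemma graph_mx_unit p : Om p -> graph_mx p \in unitmx.
Proof.
move=> Op; rewrite -row_free_unit; apply: inj_row_free => v vN.
(* The coordinates [u] occupy positions 2, 3, 4, hence the shift by 2; positions 0 and 1 stay
   untouched to keep the intrinsic form. *)
pose X : 'rV[C]_5 := Lb p + \row_k (if (k < 2)%N then 0 else v 0 (inord (k - 2))).
have X01 (a : nat) : (a < 2)%N -> X 0 (inord a) = Lb p 0 (inord a).
  by move=> a2; rewrite !mxE inordK ?a2 ?addr0 // (leq_trans a2).
have Xu : urow X = urow (Lb p) + v.
  apply/rowP => j; rewrite !mxE inordK; last by rewrite ord2_lt5.
  by congr (_ + v 0 _); apply: val_inj; rewrite /= subSS subSS subn0 inordK.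
have [h0 h1] := Lb_intrinsic Op.
have XL : X = Lb p.
  apply/(Lb_generator Op); have iX : intrinsic_form X by split; rewrite X01.
  split=> //; split=> [|j]; first exact: vapply_z.
  by rewrite vapply_w // !X01 // h0 h1 Xu mulmxDl vN addr0 Lb_eq // mxE.
by apply: (addrI (urow (Lb p))); rewrite addr0 -Xu XL.
Qed.

Lemma smooth_Lb : smooth_row Om Lb.
Proof.
have sphi j k m : cdiff Om m (fun p => Complex (rpartial k (phi j) p) 0).
  exact: (smooth_cdiff Om_open (phi_smooth j) [:: k] m).
have sg k l m : cdiff Om m (fun p => graph_row k p 0 l).
  apply: (@cdiff_eq _ _ _ Om_open _ (fun p => 'i * Complex (rpartial (inord k) (phi l) p) 0)).
    by move=> y _; rewrite mxE.
  by apply: cdiffM => //; exact: cdiff_cst.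
have sN i j m : cdiff Om m (fun p => graph_mx p i j).
  apply: (@cdiff_eq _ _ _ Om_open _ (fun p => (i == j)%:R + 'i * Complex (rpartial (inord (2 + i)) (phi j) p) 0)).
    by move=> y _; rewrite mxE.
  apply: cdiffD => //; first exact: cdiff_cst.
  by apply: cdiffM => //; exact: cdiff_cst.
move=> m k.
(* The first two components are the constants [1/2] and [i/2] imposed by the intrinsic form. *)
have [k2|k2] := ltnP k 2.
  apply: (@cdiff_eq _ _ _ Om_open _ (fun=> if k == 0%N :> nat then 2^-1 else 'i / 2)).
    move=> y /Lb_intrinsic[h0 h1]; case: k k2 => [[|[|//]] kk] _ /=.
      by rewrite -h0; congr (Lb y 0 _); apply: val_inj; rewrite /= inordK.
    by rewrite -h1; congr (Lb y 0 _); apply: val_inj; rewrite /= inordK.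
  exact: cdiff_cst.
pose j : 'I_3 := inord (k - 2).
(* The other components solve the linear system [Lb_eq], whose coefficients are built from constants
   and first partial derivatives of [phi]. *)
apply: (@cdiff_eq _ _ _ Om_open _ (fun p => - \sum_l (2^-1 * graph_row 0 p 0 l
   + ('i / 2) * graph_row 1 p 0 l) * invmx (graph_mx p) l j)).
  move=> y Oy; have := Lb_eq Oy; move/eqP; rewrite addrC addr_eq0 => /eqP.
  move/(canRL (mulmxK (graph_mx_unit Oy)))/(congr1 (fun M : 'rV_3 => M 0 j)).
  rewrite mulNmx [LHS]mxE [RHS]mxE [X in _ = - X]mxE => e; rewrite [RHS](_ : _ = Lb y 0 (inord (2 + j))).
    rewrite e; congr (- _); apply: eq_bigr => l _; congr (_ * _).
    by rewrite [RHS]mxE; congr (_ + _); rewrite [RHS]mxE.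
  congr (Lb y 0 _); apply: val_inj; rewrite /= [nat_of_ord j]inordK; last first.
    by rewrite ltn_subLR // ltn_ord.
  by rewrite addnC subnK // inordK.
apply: cdiffN => //; apply: cdiff_sum => // l; apply: cdiffM => //.
  by apply: cdiffD => //; apply: cdiffM => //; exact: cdiff_cst.
by apply: cdiff_invmx => //; exact: graph_mx_unit.
Qed.

End CRGraph.

(** * Initial frame and coframe *)

(* Complex conjugation permutes the rows of [frame]. *)
Definition conj_index (i : nat) : nat := nth i [:: 1; 0; 2; 4; 3]%N i.

Section ConjRow.
Variables (K : realType) (n : nat).
Implicit Types u v : 'rV[K[i]]_n.+1.

Lemma conj_rowK : involutive (@conj_row K n).
Proof. by move=> v; apply/rowP => k; rewrite !mxE conjCK. Qed.

Lemma conj_rowD u v : conj_row (u + v) = conj_row u + conj_row v.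
Proof. by apply/rowP => k; rewrite !mxE rmorphD. Qed.

Lemma conj_rowZ c v : conj_row (c *: v) = c^* *: conj_row v.
Proof. by apply/rowP => k; rewrite !mxE rmorphM. Qed.

Lemma conj_row_comb a b c u v w : conj_row (a *: u + b *: v + c *: w) =
  a^* *: conj_row u + b^* *: conj_row v + c^* *: conj_row w.
Proof. by rewrite !conj_rowD !conj_rowZ. Qed.

Lemma conj_row0 : conj_row 0 = 0 :> 'rV[K[i]]_n.+1.
Proof. by apply/rowP => k; rewrite !mxE conjC0. Qed.

End ConjRow.

(** Pointwise data in the order [Sb, S, T, Lb, L], stated for arbitrary vectors so that later
    computations never unfold brackets. The values follow [d w (X, Y) = w ([Y, X])]: for instance
    [[L, T] = S] gives [dcoframe_TL], and [[L, Lb] = - i T] gives [dcoframe_LLb]. For the forms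
    other than [sigma_0], the five combinations require only values on pairs among [T], [L],
    [Lb]. *)
Record adapted_frame (K : realType) (X w : nat -> 'rV[K[i]]_5)
    (dw : nat -> 'M[K[i]]_5) (Q R B G : K[i]) : Prop := AdaptedFrame {
  frame_dual : forall i j, (i < 5)%N -> (j < 5)%N -> pairing (w i) (X j) = (i == j)%:R;
  frame_conj : forall j, (j < 5)%N -> conj_row (X j) = X (conj_index j);
  coframe_conj : forall i, (i < 5)%N -> conj_row (w i) = w (conj_index i);
  dcoframe_conj : forall i, (i < 5)%N ->
    map_mx (fun z : K[i] => z^*) (dw i) = dw (conj_index i);
  dcoframe_antisym : forall i, antisym (dw i);
  dcoframe_TL : forall i, (i < 5)%N -> feval (dw i) (X 2) (X 4) = (i == 1%N)%:R;
  dcoframe_TLb : forall i, (i < 5)%N -> feval (dw i) (X 2) (X 3) = (i == 0%N)%:R;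
  dcoframe_LLb : forall i, (i < 5)%N -> feval (dw i) (X 4) (X 3) = 'i * (i == 2%N)%:R;
  dsigma_SL : feval (dw 1) (X 1%N) (X 4) = Q;
  dsigma_SLb : feval (dw 1) (X 1%N) (X 3) = B;
  dsigma_SbL : feval (dw 1) (X 0%N) (X 4) = B;
  dsigma_SbLb : feval (dw 1) (X 0%N) (X 3) = R^*;
  dsigma_SbT : feval (dw 1) (X 0%N) (X 2) = G^*
}.

Section FrameDual.
Variables (K : realType) (Om : set 'rV[K]_5) (Lb : 'rV[K]_5 -> 'rV[K[i]]_5).
Variables (P Q R A B E' F G : 'rV[K]_5 -> K[i]).
Hypotheses (Om_open : open Om) (Lb_smooth : smooth_row Om Lb).
Hypothesis M_maxmin : maximally_minimal Lb Om.
Hypothesis brackets : bracket_relations Lb Om P Q R A B E' F G.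
Notation C := K[i].
Notation E := 'rV[K]_5.

Definition frame_field (j : nat) : E -> 'rV[C]_5 :=
  nth (fun=> 0) [:: fSb Lb; fS Lb; fT Lb; Lb; fL Lb] j.

Lemma smooth_fL : smooth_row Om (fL Lb).
Proof. exact: smooth_conj. Qed.

Lemma smooth_fT : smooth_row Om (fT Lb).
Proof.
apply: smooth_scale => //; apply: smooth_bracket => //; exact: smooth_fL.
Qed.

Lemma smooth_fS : smooth_row Om (fS Lb).
Proof. by apply: smooth_bracket => //; [exact: smooth_fL|exact: smooth_fT]. Qed.

Lemma smooth_fSb : smooth_row Om (fSb Lb).
Proof. by apply: smooth_bracket => //; exact: smooth_fT. Qed.

Lemma smooth_frame_field j : smooth_row Om (frame_field j).
Proof.
case: j => [|[|[|[|[|j]]]]] //; [exact: smooth_fSb|exact: smooth_fS|exact: smooth_fT|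
  exact: smooth_fL|].
by move=> m k; apply: cdiff_eq (cdiff_cst Om_open m 0) => // y _;
  rewrite /frame_field nth_default // mxE.
Qed.

Lemma row_frame p j : (j < 5)%N -> row (inord j) (frame Lb p) = frame_field j p.
Proof.
by move=> j5; rewrite rowK inordK //; case: j j5 => [|[|[|[|[|j]]]]].
Qed.

Lemma pairing_dual p i j : Om p -> (i < 5)%N -> (j < 5)%N ->
  pairing (dual_form Lb i p) (frame_field j p) = (i == j)%:R.
Proof.
move=> Op i5 j5; have := mulmxV (M_maxmin Op).
move/matrixP/(_ (inord j) (inord i)); rewrite [LHS]mxE [RHS]mxE => H.
rewrite (_ : (i == j) = (inord j == inord i :> 'I_5)); last first.
  by apply/eqP/eqP => [->//|/(congr1 val)]; rewrite /= !inordK.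
rewrite -H -row_frame //; apply: eq_bigr => k _.
by rewrite mulrC [in LHS]mxE; congr (_ * _); rewrite /dual_form [LHS]mxE [LHS]mxE.
Qed.

Lemma dual_ext p (v w : 'rV[C]_5) : Om p ->
  (forall j, (j < 5)%N -> pairing v (frame_field j p) = pairing w (frame_field j p)) ->
  v = w.
Proof.
move=> Op H; apply: (can_inj (mulmxK (_ : (frame Lb p)^T \in unitmx))).
  by rewrite unitmx_tr; exact: M_maxmin.
apply/rowP => j; have := H j (ltn_ord j).
rewrite -row_frame // inord_val /pairing => Hj.
rewrite [LHS]mxE [RHS]mxE; apply: etrans (etrans Hj _).
  by apply: eq_bigr => k _; congr (_ * _); rewrite [LHS]mxE [RHS]mxE.
by apply: eq_bigr => k _; congr (_ * _); rewrite [LHS]mxE [RHS]mxE.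
Qed.

Lemma smooth_dual i : smooth_row Om (dual_form Lb i).
Proof.
move=> m k; apply: (@cdiff_eq _ _ _ Om_open _ (fun p => invmx (frame Lb p) k (inord i))).
  by move=> p _; rewrite /dual_form [RHS]mxE [RHS]mxE.
apply: cdiff_invmx => // u v.
apply: cdiff_eq (smooth_frame_field u m v) => // p _.
by rewrite -row_frame // inord_val mxE.
Qed.

(** Conjugation exchanges [L] and [Lb], which reverses the sign of their bracket; the factor [i] in
    [fT] compensates. *)
Lemma conj_fT p : Om p -> conj_row (fT Lb p) = fT Lb p.
Proof.
move=> Op; rewrite /fT.
transitivity (- 'i *: conj_row (bracket (fL Lb) Lb p)).
  by rewrite conj_rowZ conjCi.
rewrite (conj_bracket smooth_fL Lb_smooth Op) bracketC scaleNr scalerN opprK.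
rewrite (_ : (fun y => conj_row (fL Lb y)) = Lb) //.
by apply/funext => y; exact: conj_rowK.
Qed.

Lemma conj_fS p : Om p -> conj_row (fS Lb p) = fSb Lb p.
Proof.
move=> Op; rewrite /fS (conj_bracket smooth_fL smooth_fT Op).
apply: (bracket_eq Om_open _ _ Op) => y Oy; [exact: conj_rowK|exact: conj_fT].
Qed.

Lemma conj_fSb p : Om p -> conj_row (fSb Lb p) = fS Lb p.
Proof. by move=> Op; rewrite -(conj_fS Op) conj_rowK. Qed.

Lemma conj_frame p j : Om p -> conj_row (frame_field j p) = frame_field (conj_index j) p.
Proof.
move=> Op; case: j => [|[|[|[|[|j]]]]] /=.
- exact: conj_fSb.
- exact: conj_fS.
- exact: conj_fT.
- by [].
- exact: conj_rowK.
by rewrite /conj_index /frame_field !nth_default //; exact: conj_row0.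
Qed.

Lemma conj_indexK : involutive conj_index.
Proof. by do 5?case=> //; move=> j; rewrite /conj_index !nth_default. Qed.

Lemma conj_index_lt i : (i < 5)%N -> (conj_index i < 5)%N.
Proof. by do 5?case: i => // i. Qed.

(** Both sides take the same values on the frame, since conjugation permutes the frame by an
    involution and fixes 0 and 1. *)
Lemma conj_dual p i : Om p -> (i < 5)%N ->
  conj_row (dual_form Lb i p) = dual_form Lb (conj_index i) p.
Proof.
move=> Op i5; apply: (dual_ext Op) => j j5.
rewrite -[frame_field j p]conj_rowK -pairing_conj conj_frame // pairing_dual ?conj_index_lt //.
rewrite conj_frame ?conj_index_lt // conj_indexK pairing_dual ?conj_index_lt //.
by rewrite conjC_nat -(inj_eq (inv_inj conj_indexK)) conj_indexK.
Qed.

Lemma has_partials_dual i p : Om p -> has_partials_row (dual_form Lb i) p.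
Proof. by move=> Op k j; apply: (cdiff_has_partial _ (smooth_dual i 1%N j) Op). Qed.

Lemma conj_dform_dual p i : Om p -> (i < 5)%N ->
  map_mx (fun z : C => z^*) (dform (dual_form Lb i) p) =
  dform (dual_form Lb (conj_index i)) p.
Proof.
move=> Op i5; rewrite -dform_conj; last exact: has_partials_dual.
by apply: (dform_eq Om_open _ Op) => y Oy; exact: conj_dual.
Qed.

Lemma dform_dual p i j k : Om p -> (i < 5)%N -> (j < 5)%N -> (k < 5)%N ->
  feval (dform (dual_form Lb i) p) (frame_field j p) (frame_field k p) =
  - pairing (dual_form Lb i p) (bracket (frame_field j) (frame_field k) p).
Proof.
move=> Op i5 j5 k5; apply: (cartan_const Om_open (smooth_dual i) (smooth_frame_field j)
  (smooth_frame_field k) Op); by move=> y Oy; rewrite pairing_dual.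
Qed.

Lemma bracket_L_Lb p : bracket (fL Lb) Lb p = - 'i *: fT Lb p.
Proof. by rewrite scalerA mulNr -expr2 sqrCi opprK scale1r. Qed.

(** Conjugate of the relation for [[L, S]]; it is the source of the conjugate of [R] in [U5] and
    [U7]. In the same way [bracket_T_Sb] supplies the conjugate of [G]. *)
Lemma bracket_Lb_Sb p : Om p -> bracket Lb (fSb Lb) p =
  (P p)^* *: fT Lb p + (Q p)^* *: fSb Lb p + (R p)^* *: fS Lb p.
Proof.
move=> Op; have [H _ _ _] := brackets Op.
transitivity (conj_row (bracket (fL Lb) (fS Lb) p)).
  rewrite (conj_bracket smooth_fL smooth_fS Op).
  apply: (bracket_eq Om_open _ _ Op) => y Oy; first by rewrite conj_rowK.
  by rewrite conj_fS.
(* Generalized so that unification does not unfold the iterated brackets. *)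
rewrite H conj_row_comb; move: (conj_fT Op) (conj_fS Op) (conj_fSb Op).
by move: (fT Lb p) (fS Lb p) (fSb Lb p) => T S Sb -> -> ->.
Qed.

Lemma bracket_T_Sb p : Om p -> bracket (fT Lb) (fSb Lb) p =
  (E' p)^* *: fT Lb p + (F p)^* *: fSb Lb p + (G p)^* *: fS Lb p.
Proof.
move=> Op; have [_ _ _ H] := brackets Op.
transitivity (conj_row (bracket (fT Lb) (fS Lb) p)).
  rewrite (conj_bracket smooth_fT smooth_fS Op).
  apply: (bracket_eq Om_open _ _ Op) => y Oy; first by rewrite conj_fT.
  by rewrite conj_fS.
rewrite H conj_row_comb; move: (conj_fT Op) (conj_fS Op) (conj_fSb Op).
by move: (fT Lb p) (fS Lb p) (fSb Lb p) => T S Sb -> -> ->.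
Qed.

Lemma frame_adapted p : Om p ->
  adapted_frame (fun j => frame_field j p) (fun i => dual_form Lb i p)
    (fun i => dform (dual_form Lb i) p) (Q p) (R p) (B p) (G p).
Proof.
move=> Op.
(* Exchanging the two fields in the bracket absorbs the minus sign of [dform_dual]. *)
have D i (j k : nat) V : (i < 5)%N -> (j < 5)%N -> (k < 5)%N ->
    bracket (frame_field k) (frame_field j) p = V ->
    feval (dform (dual_form Lb i) p) (frame_field j p) (frame_field k p) =
    pairing (dual_form Lb i p) V.
  by move=> i5 j5 k5 <-; rewrite dform_dual // bracketC pairingNr opprK.
have [bLS bLbS bLSb bTS] := brackets Op.
have comb i x y z j k l : (i < 5)%N -> (j < 5)%N -> (k < 5)%N -> (l < 5)%N ->
    pairing (dual_form Lb i p)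
      (x *: frame_field j p + y *: frame_field k p + z *: frame_field l p) =
    x * (i == j)%:R + y * (i == k)%:R + z * (i == l)%:R.
  by move=> i5 j5 k5 l5; rewrite !pairingDr !pairingZr !pairing_dual.
split.
- by move=> i j; exact: pairing_dual.
- by move=> j _; exact: conj_frame.
- by move=> i; exact: conj_dual.
- by move=> i; exact: conj_dform_dual.
- by move=> i; exact: antisym_dform.
- by move=> i i5; rewrite (D i 2%N 4%N (frame_field 1 p)) // pairing_dual.
- by move=> i i5; rewrite (D i 2%N 3%N (frame_field 0 p)) // pairing_dual.
- move=> i i5; rewrite -(pairing_dual Op i5 (isT : (2 < 5)%N)) -pairingZr.
  apply: D => //; apply: etrans (bracketC _ _ _) _.
  by apply: etrans (congr1 -%R (bracket_L_Lb p)) _; rewrite scaleNr opprK.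
- apply: etrans (D 1%N 1%N 4%N (P p *: frame_field 2 p + Q p *: frame_field 1 p
    + R p *: frame_field 0 p) isT isT isT bLS) _.
  by rewrite comb //= !mulr0 mulr1 ?add0r ?addr0.
- apply: etrans (D 1%N 1%N 3%N (A p *: frame_field 2 p + B p *: frame_field 1 p
    + (B p)^* *: frame_field 0 p) isT isT isT bLbS) _.
  by rewrite comb //= !mulr0 mulr1 ?add0r ?addr0.
- apply: etrans (D 1%N 0%N 4%N (A p *: frame_field 2 p + B p *: frame_field 1 p
    + (B p)^* *: frame_field 0 p) isT isT isT bLSb) _.
  by rewrite comb //= !mulr0 mulr1 ?add0r ?addr0.
- apply: etrans (D 1%N 0%N 3%N ((P p)^* *: frame_field 2 p + (Q p)^* *: frame_field 0 p
    + (R p)^* *: frame_field 1 p) isT isT isT (bracket_Lb_Sb Op)) _.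
  by rewrite comb //= !mulr0 mulr1 ?add0r ?addr0.
- apply: etrans (D 1%N 0%N 2%N ((E' p)^* *: frame_field 2 p + (F p)^* *: frame_field 0 p
    + (G p)^* *: frame_field 1 p) isT isT isT (bracket_T_Sb Op)) _.
  by rewrite comb //= !mulr0 mulr1 ?add0r ?addr0.
Qed.

End FrameDual.

Section Conjugation.
Variable K : realType.
Implicit Types x y : K[i].

Lemma conjD x y : (x + y)^* = x^* + y^*. Proof. exact: rmorphD. Qed.
Lemma conjN x : (- x)^* = - x^*. Proof. exact: rmorphN. Qed.
Lemma conjM x y : (x * y)^* = x^* * y^*. Proof. exact: rmorphM. Qed.
Lemma conjX x n : (x ^+ n)^* = x^* ^+ n. Proof. exact: rmorphXn. Qed.
Lemma conjV x : x^-1^* = x^*^-1. Proof. exact: fmorphV. Qed.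

End Conjugation.

Section Wedge.
Variables (K : realType) (n : nat).
Notation C := K[i].
Implicit Types u v w : 'rV[C]_n.+1.

Lemma feval_wedge u v X Y :
  feval (wedge u v) X Y = pairing u X * pairing v Y - pairing v X * pairing u Y.
Proof.
rewrite /pairing !mulr_suml -sumrB; apply: eq_bigr => i _.
by rewrite !mulr_sumr -sumrB; apply: eq_bigr => j _; rewrite !mxE; ring.
Qed.

Definition two_form (sb s r zb z : 'rV[C]_n.+1) (c : C * C * C * C * C * C * C * C * C * C) :=
  let: (c1, c2, c3, c4, c5, c6, c7, c8, c9, c10) := c in
  c1 *: wedge s sb + c2 *: wedge s r + c3 *: wedge s z + c4 *: wedge s zb
  + c5 *: wedge sb r + c6 *: wedge sb z + c7 *: wedge sb zb
  + c8 *: wedge r z + c9 *: wedge r zb + c10 *: wedge z zb.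

End Wedge.

(** * Lifted coframe at a point *)

Section Lifted.
Variables (K : realType) (X w : nat -> 'rV[K[i]]_5) (dw : nat -> 'M[K[i]]_5).
Variables (Q R B G : K[i]).
Hypothesis adapted : adapted_frame X w dw Q R B G.
Variables (a b c d e : K[i]).
Hypothesis a0 : a != 0.
Notation C := K[i].

(* Indices follow [frame]: 0, ..., 4 stand for sigmab, sigma, rho, zetab, zeta. *)
Definition lifted_sigma := (a ^+ 2 * a^*) *: w 1%N.
Definition lifted_rho := c^* *: w 0%N + c *: w 1%N + (a * a^*) *: w 2.
Definition lifted_zeta := d^* *: w 0%N + e *: w 1%N + b *: w 2 + a *: w 4.

Definition lifted_form (i : nat) : 'rV[C]_5 :=
  nth 0 [:: conj_row lifted_sigma; lifted_sigma; lifted_rho; conj_row lifted_zeta; lifted_zeta] i.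

(** Each initial vector [X j] is the sum of the dual vectors weighted by the values of the lifted
    forms on [X j]. This system is triangular, and these definitions solve it by back substitution
    from [zeta] up to [sigmab]. *)
Definition dual_zeta := a^-1 *: X 4.
Definition dual_zetab := (a^*)^-1 *: X 3.
Definition dual_rho := (a * a^*)^-1 *: (X 2 + - b *: dual_zeta + - b^* *: dual_zetab).
Definition dual_sigma := (a ^+ 2 * a^*)^-1 *:
  (X 1%N + - c *: dual_rho + - e *: dual_zeta + - d *: dual_zetab).
Definition dual_sigmab := (a * a^* ^+ 2)^-1 *:
  (X 0%N + - c^* *: dual_rho + - d^* *: dual_zeta + - e^* *: dual_zetab).

Definition lifted_field (j : nat) : 'rV[C]_5 :=
  nth 0 [:: dual_sigmab; dual_sigma; dual_rho; dual_zetab; dual_zeta] j.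

Let ab0 : a^* != 0. Proof. by rewrite conjC_eq0. Qed.

Let cw k l : (k < 5)%N -> conj_index k = l -> conj_row (w k) = w l.
Proof. by move=> k5 <-; exact: (coframe_conj adapted). Qed.
Let cw0 := cw (isT : (0 < 5)%N) (erefl 1%N).
Let cw1 := cw (isT : (1 < 5)%N) (erefl 0%N).
Let cw2 := cw (isT : (2 < 5)%N) (erefl 2%N).
Let cw4 := cw (isT : (4 < 5)%N) (erefl 3%N).
Let cX k l : (k < 5)%N -> conj_index k = l -> conj_row (X k) = X l.
Proof. by move=> k5 <-; exact: (frame_conj adapted). Qed.

Lemma conj_lifted_sigma : conj_row lifted_sigma = (a * a^* ^+ 2) *: w 0%N.
Proof. by rewrite conj_rowZ cw1 conjM conjX conjCK [X in X *: _]mulrC. Qed.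

Lemma conj_lifted_rho : conj_row lifted_rho = lifted_rho.
Proof.
rewrite !conj_rowD !conj_rowZ cw0 cw1 cw2 conjCK conjM conjCK [a^* * a]mulrC.
by rewrite [c *: _ + _]addrC.
Qed.

Lemma conj_lifted_zeta : conj_row lifted_zeta =
  e^* *: w 0%N + d *: w 1%N + b^* *: w 2 + a^* *: w 3.
Proof.
by rewrite !conj_rowD !conj_rowZ cw0 cw1 cw2 cw4 conjCK [d *: _ + _]addrC.
Qed.

Lemma pairing_lifted i j : (i < 5)%N -> (j < 5)%N ->
  pairing (lifted_form i) (lifted_field j) = (i == j)%:R.
Proof.
have P0 k l : (k < 5)%N -> (l < 5)%N -> pairing (w k) (X l) = (k == l)%:R.
  exact: (frame_dual adapted).
have wz k : (k < 5)%N -> pairing (w k) dual_zeta = a^-1 * (k == 4%N)%:R.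
  by move=> k5; rewrite pairingZr P0.
have wzb k : (k < 5)%N -> pairing (w k) dual_zetab = a^*^-1 * (k == 3%N)%:R.
  by move=> k5; rewrite pairingZr P0.
have lin3 k x p y q z v : pairing v (k *: (x + p *: y + q *: z)) =
    k * (pairing v x + p * pairing v y + q * pairing v z).
  by rewrite !(pairingZr, pairingDr).
have lin4 k x p y q z r t v : pairing v (k *: (x + p *: y + q *: z + r *: t)) =
    k * (pairing v x + p * pairing v y + q * pairing v z + r * pairing v t).
  by rewrite !(pairingZr, pairingDr).
have wr v : pairing v dual_rho = (a * a^*)^-1 *
    (pairing v (X 2) + - b * pairing v dual_zeta + - b^* * pairing v dual_zetab).
  exact: lin3.
have ws v : pairing v dual_sigma = (a ^+ 2 * a^*)^-1 *
    (pairing v (X 1%N) + - c * pairing v dual_rho + - e * pairing v dual_zeta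
     + - d * pairing v dual_zetab).
  exact: lin4.
have wsb v : pairing v dual_sigmab = (a * a^* ^+ 2)^-1 *
    (pairing v (X 0%N) + - c^* * pairing v dual_rho + - d^* * pairing v dual_zeta
     + - e^* * pairing v dual_zetab).
  exact: lin4.
have ls v : pairing lifted_sigma v = (a ^+ 2 * a^*) * pairing (w 1%N) v.
  exact: pairingZl.
have lsb v : pairing ((a * a^* ^+ 2) *: w 0%N) v = (a * a^* ^+ 2) * pairing (w 0%N) v.
  exact: pairingZl.
have lr v : pairing lifted_rho v = c^* * pairing (w 0%N) v + c * pairing (w 1%N) v
    + (a * a^*) * pairing (w 2) v.
  by rewrite !pairingDl !pairingZl.
have lz v : pairing lifted_zeta v = d^* * pairing (w 0%N) v + e * pairing (w 1%N) v
    + b * pairing (w 2) v + a * pairing (w 4) v.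
  by rewrite !pairingDl !pairingZl.
have lzb v : pairing (e^* *: w 0%N + d *: w 1%N + b^* *: w 2 + a^* *: w 3) v =
    e^* * pairing (w 0%N) v + d * pairing (w 1%N) v
    + b^* * pairing (w 2) v + a^* * pairing (w 3) v.
  by rewrite !pairingDl !pairingZl.
rewrite /lifted_form /lifted_field conj_lifted_sigma conj_lifted_zeta.
(* Conjugates become independent variables, so that only rational identities are left for
   [field]. *)
move: (a^*) (b^*) (c^*) (d^*) (e^*) ab0 ls lsb lr lz lzb wz wzb wr ws wsb P0.
move: lifted_sigma lifted_rho lifted_zeta dual_zeta dual_zetab dual_rho dual_sigma dual_sigmab.
move=> l1 l2 l4 y4 y3 y2 y1 y0 ab bb cb db eb ab0' ls lsb lr lz lzb wz wzb wr ws wsb P0.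
have [y4_0 y4_1 y4_2 y4_3 y4_4] : [/\ pairing (w 0%N) y4 = 0, pairing (w 1%N) y4 = 0,
    pairing (w 2) y4 = 0, pairing (w 3) y4 = 0 & pairing (w 4) y4 = a^-1].
  by split; rewrite wz //= ?mulr0 ?mulr1.
have [y3_0 y3_1 y3_2 y3_3 y3_4] : [/\ pairing (w 0%N) y3 = 0, pairing (w 1%N) y3 = 0,
    pairing (w 2) y3 = 0, pairing (w 3) y3 = ab^-1 & pairing (w 4) y3 = 0].
  by split; rewrite wzb //= ?mulr0 ?mulr1.
have v2 k : (k < 5)%N -> pairing (w k) (X 2) = (k == 2%N)%:R by move=> k5; exact: P0.
have v1 k : (k < 5)%N -> pairing (w k) (X 1%N) = (k == 1%N)%:R by move=> k5; exact: P0.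
have v0 k : (k < 5)%N -> pairing (w k) (X 0%N) = (k == 0%N)%:R by move=> k5; exact: P0.
have [y2_0 y2_1 y2_2 y2_3 y2_4] : [/\ pairing (w 0%N) y2 = 0, pairing (w 1%N) y2 = 0,
    pairing (w 2) y2 = (a * ab)^-1, pairing (w 3) y2 = - bb / (a * ab ^+ 2) &
    pairing (w 4) y2 = - b / (a ^+ 2 * ab)].
  split; rewrite wr v2 //= ?(y4_0, y4_1, y4_2, y4_3, y4_4, y3_0, y3_1, y3_2, y3_3, y3_4);
  by field; rewrite ?a0 ?ab0'.
have v3 := (y4_0, y4_1, y4_2, y4_3, y4_4, y3_0, y3_1, y3_2, y3_3, y3_4,
  y2_0, y2_1, y2_2, y2_3, y2_4).
move=> i5 j5; case: i i5 => [|[|[|[|[|//]]]]] _; case: j j5 => [|[|[|[|[|//]]]]] _ /=;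
rewrite ?(ls, lsb, lr, lz, lzb) ?(ws, wsb) ?v0 ?v1 // ?v3 /=;
by field; rewrite ?a0 ?ab0'.
Qed.


Let lin3 k x p u q v : conj_row (k *: (x + p *: u + q *: v)) =
  k^* *: (conj_row x + p^* *: conj_row u + q^* *: conj_row v) :> 'rV[C]_5.
Proof. by rewrite conj_rowZ !conj_rowD !conj_rowZ. Qed.

Let lin4 k x p u q v r y : conj_row (k *: (x + p *: u + q *: v + r *: y)) =
  k^* *: (conj_row x + p^* *: conj_row u + q^* *: conj_row v + r^* *: conj_row y)
  :> 'rV[C]_5.
Proof. by rewrite conj_rowZ !conj_rowD !conj_rowZ. Qed.

Lemma conj_lifted_field j : (j < 5)%N ->
  conj_row (lifted_field j) = lifted_field (conj_index j).
Proof.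
have cz : conj_row dual_zeta = dual_zetab.
  by rewrite conj_rowZ (cX (isT : (4 < 5)%N) (erefl 3%N)) conjV.
have czb : conj_row dual_zetab = dual_zeta by rewrite -cz conj_rowK.
have cr : conj_row dual_rho = dual_rho.
  rewrite /dual_rho lin3 cz czb (cX (isT : (2 < 5)%N) (erefl 2%N)) conjV conjM !conjN !conjCK.
  by rewrite [a^* * a]mulrC [in LHS](addrAC (X 2)).
have cs : conj_row dual_sigma = dual_sigmab.
  rewrite /dual_sigma lin4 cr cz czb (cX (isT : (1 < 5)%N) (erefl 0%N)).
  by rewrite !conjN conjV conjM conjX conjCK [a^* ^+ 2 * a]mulrC [in LHS](addrAC (X 0%N + _)).
have csb : conj_row dual_sigmab = dual_sigma by rewrite -[dual_sigma]conj_rowK cs.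
by case: j => [|[|[|[|[|//]]]]] _; [exact: csb|exact: cs|exact: cr|exact: czb|exact: cz].
Qed.

(** The ten pairs are listed in the order of the wedge products in [two_form]. *)
Definition coefficients (Om : 'M[C]_5) :=
  let f i j := feval Om (lifted_field i) (lifted_field j) in
  (f 1%N 0%N, f 1%N 2, f 1%N 4, f 1%N 3, f 0%N 2, f 0%N 4, f 0%N 3, f 2 4, f 2 3, f 4 3).

Definition lifted_two_form := two_form (lifted_form 0) (lifted_form 1)
  (lifted_form 2) (lifted_form 3) (lifted_form 4).

Lemma feval_ext Om Om' : (forall i j, (i < 5)%N -> (j < 5)%N ->
    feval Om (lifted_field i) (lifted_field j) =
    feval Om' (lifted_field i) (lifted_field j)) -> Om = Om'.
Proof.
pose Fm : 'M[C]_5 := \matrix_(i < 5) lifted_field i.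
pose Wm : 'M[C]_5 := \matrix_(i < 5) lifted_form i.
have FW : Fm *m Wm^T = 1%:M.
  apply/matrixP => i j; rewrite [LHS]mxE [RHS]mxE.
  rewrite eq_sym -[RHS](pairing_lifted (ltn_ord j) (ltn_ord i)) /pairing.
  by apply: eq_bigr => k _; rewrite !mxE mulrC.
have [uF _] := mulmx1_unit FW.
have E (M : 'M[C]_5) (i j : 'I_5) : (Fm *m M *m Fm^T) i j =
    feval M (lifted_field i) (lifted_field j).
  rewrite /feval exchange_big [LHS]mxE; apply: eq_bigr => l _.
  rewrite [X in X * _]mxE mulr_suml; apply: eq_bigr => k _.
  by congr (_ * _ * _); rewrite !mxE.
move=> H; apply: (can_inj (mulKmx uF)).
apply: (can_inj (mulmxK (_ : Fm^T \in unitmx))); first by rewrite unitmx_tr.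
by apply/matrixP => i j; rewrite !E H.
Qed.

Lemma feval_lifted_two_form c1 c2 c3 c4 c5 c6 c7 c8 c9 c10 i j :
  (i < 5)%N -> (j < 5)%N ->
  feval (lifted_two_form (c1, c2, c3, c4, c5, c6, c7, c8, c9, c10))
    (lifted_field i) (lifted_field j) =
  let m k l := (k == i)%N%:R * (l == j)%N%:R - (l == i)%N%:R * (k == j)%N%:R in
  c1 * m 1%N 0%N + c2 * m 1%N 2%N + c3 * m 1%N 4%N + c4 * m 1%N 3%N + c5 * m 0%N 2%N
  + c6 * m 0%N 4%N + c7 * m 0%N 3%N + c8 * m 2%N 4%N + c9 * m 2%N 3%N + c10 * m 4%N 3%N.
Proof.
move=> i5 j5.
have W k l : (k < 5)%N -> (l < 5)%N ->
    feval (wedge (lifted_form k) (lifted_form l)) (lifted_field i) (lifted_field j) =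
    (k == i)%N%:R * (l == j)%N%:R - (l == i)%N%:R * (k == j)%N%:R.
  by move=> k5 l5; rewrite feval_wedge !pairing_lifted.
have lin (M1 M2 M3 M4 M5 M6 M7 M8 M9 M10 : 'M[C]_5) Y Z :
    feval (c1 *: M1 + c2 *: M2 + c3 *: M3 + c4 *: M4 + c5 *: M5 + c6 *: M6 + c7 *: M7
      + c8 *: M8 + c9 *: M9 + c10 *: M10) Y Z =
    c1 * feval M1 Y Z + c2 * feval M2 Y Z + c3 * feval M3 Y Z + c4 * feval M4 Y Z
    + c5 * feval M5 Y Z + c6 * feval M6 Y Z + c7 * feval M7 Y Z + c8 * feval M8 Y Z
    + c9 * feval M9 Y Z + c10 * feval M10 Y Z.
  by rewrite !fevalD !fevalZ.
apply: etrans (lin _ _ _ _ _ _ _ _ _ _ _ _) _.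
do 9?[apply: (congr2 +%R); last by apply: (congr1 ( *%R _)); exact: W].
by apply: (congr1 ( *%R _)); exact: W.
Qed.

(** With [lifted_two_formK], this says that the ten wedge products form a basis of the 2-forms at a
    point; existence and uniqueness of the torsion rest on it. *)
Lemma coefficientsK c' : coefficients (lifted_two_form c') = c'.
Proof.
case: c' => [[[[[[[[[c1 c2] c3] c4] c5] c6] c7] c8] c9] c10].
by rewrite /coefficients; congr (_, _, _, _, _, _, _, _, _, _);
  rewrite feval_lifted_two_form //=; ring.
Qed.

Lemma lifted_two_formK Om : antisym Om -> lifted_two_form (coefficients Om) = Om.
Proof.
move=> aO; apply: feval_ext => i j i5 j5.
pose f k l := feval Om (lifted_field k) (lifted_field l).
have fC k l : f k l = - f l k by exact: fevalC.
have fd k : f k k = 0 by exact: feval_diag.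
rewrite (_ : coefficients Om = (f 1%N 0%N, f 1%N 2%N, f 1%N 4%N, f 1%N 3%N, f 0%N 2%N,
  f 0%N 4%N, f 0%N 3%N, f 2%N 4%N, f 2%N 3%N, f 4%N 3%N)) //.
rewrite feval_lifted_two_form // -[RHS]/(f i j); move: f fC fd => f fC fd.
case: i i5 => [|[|[|[|[|//]]]]] _; case: j j5 => [|[|[|[|[|//]]]]] _ /=;
  try (rewrite fd; ring); try ring; by rewrite [RHS]fC; ring.
Qed.

(** This and the next two are the exterior derivatives of the lifted forms with the group parameters
    held constant. *)
Definition lifted_dsigma := (a ^+ 2 * a^*) *: dw 1%N.
Definition lifted_drho := c^* *: dw 0%N + c *: dw 1%N + (a * a^*) *: dw 2%N.
Definition lifted_dzeta := d^* *: dw 0%N + e *: dw 1%N + b *: dw 2%N + a *: dw 4%N.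

Section FieldValues.
Variable M : 'M[C]_5.
Hypothesis aM : antisym M.
Let t j k := feval M (X j) (X k).
Let f j k := feval M (lifted_field j) (lifted_field k).

Let fC j k : f j k = - f k j. Proof. exact: fevalC. Qed.
Let fd j : f j j = 0. Proof. exact: feval_diag. Qed.
Let flin3 k x p y q z v : feval M (k *: (x + p *: y + q *: z)) v =
  k * (feval M x v + p * feval M y v + q * feval M z v).
Proof. by rewrite !(fevalZl, fevalDl). Qed.
Let flin3r k x p y q z v : feval M v (k *: (x + p *: y + q *: z)) =
  k * (feval M v x + p * feval M v y + q * feval M v z).
Proof. by rewrite !(fevalZr, fevalDr). Qed.
Let flin4 k x p y q z r u v : feval M (k *: (x + p *: y + q *: z + r *: u)) v =
  k * (feval M x v + p * feval M y v + q * feval M z v + r * feval M u v).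
Proof. by rewrite !(fevalZl, fevalDl). Qed.

Let X4 v : feval M v (lifted_field 4) = a^-1 * feval M v (X 4).
Proof. exact: fevalZr. Qed.
Let X3 v : feval M v (lifted_field 3) = a^*^-1 * feval M v (X 3).
Proof. exact: fevalZr. Qed.
Let X2 v : feval M v (lifted_field 2) = (a * a^*)^-1 *
  (feval M v (X 2) + - b * feval M v (lifted_field 4) + - b^* * feval M v (lifted_field 3)).
Proof. exact: flin3r. Qed.
Let Y4 v : feval M (lifted_field 4) v = a^-1 * feval M (X 4) v.
Proof. exact: fevalZl. Qed.
Let Y2 v : feval M (lifted_field 2) v = (a * a^*)^-1 *
  (feval M (X 2) v + - b * feval M (lifted_field 4) v + - b^* * feval M (lifted_field 3) v).
Proof. exact: flin3. Qed.
Let Y1 v : feval M (lifted_field 1) v = (a ^+ 2 * a^*)^-1 *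
  (feval M (X 1%N) v + - c * feval M (lifted_field 2) v
   + - e * feval M (lifted_field 4) v + - d * feval M (lifted_field 3) v).
Proof. exact: flin4. Qed.
Let Y0 v : feval M (lifted_field 0) v = (a * a^* ^+ 2)^-1 *
  (feval M (X 0%N) v + - c^* * feval M (lifted_field 2) v
   + - d^* * feval M (lifted_field 4) v + - e^* * feval M (lifted_field 3) v).
Proof. exact: flin4. Qed.

(** The values are computed in the triangular order of the dual vectors: each one reduces to values
    [t] on the initial frame and to values already treated. *)
Lemma feval_lifted43 : f 4 3 = (a * a^*)^-1 * t 4 3.
Proof. by rewrite /f X3 Y4 mulrA invfM [a^-1 * _]mulrC. Qed.
Lemma feval_lifted24 : f 2 4 = (a * a^*)^-1 * (a^-1 * t 2 4 + b^* * (a * a^*)^-1 * t 4 3).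
Proof.
rewrite /f Y2 -!/(f _ _) fd (fC 3) feval_lifted43 X4 -/(t 2 4).
by rewrite mulr0 addr0 mulrNN mulrA.
Qed.
Lemma feval_lifted23 : f 2 3 = (a * a^*)^-1 * (a^*^-1 * t 2 3 - b * (a * a^*)^-1 * t 4 3).
Proof.
rewrite /f Y2 -!/(f _ _) fd feval_lifted43 X3 -/(t 2 3).
by rewrite mulr0 addr0 mulNr mulrA.
Qed.
Lemma feval_lifted14 : f 1 4 = (a ^+ 2 * a^*)^-1 * (a^-1 * t 1 4 - c * f 2 4 + d * f 4 3).
Proof.
by rewrite [LHS]Y1 -!/(f _ _) fd (fC 3) X4 -/(t 1 4) mulr0 addr0 mulrNN mulNr.
Qed.
Lemma feval_lifted13 : f 1 3 = (a ^+ 2 * a^*)^-1 * (a^*^-1 * t 1 3 - c * f 2 3 - e * f 4 3).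
Proof. by rewrite [LHS]Y1 -!/(f _ _) fd X3 -/(t 1 3) mulr0 addr0 !mulNr. Qed.
Lemma feval_lifted04 : f 0 4 = (a * a^* ^+ 2)^-1 * (a^-1 * t 0 4 - c^* * f 2 4 + e^* * f 4 3).
Proof.
by rewrite [LHS]Y0 -!/(f _ _) fd (fC 3) X4 -/(t 0 4) mulr0 addr0 mulrNN mulNr.
Qed.
Lemma feval_lifted03 : f 0 3 = (a * a^* ^+ 2)^-1 * (a^*^-1 * t 0 3 - c^* * f 2 3 - d^* * f 4 3).
Proof. by rewrite [LHS]Y0 -!/(f _ _) fd X3 -/(t 0 3) mulr0 addr0 !mulNr. Qed.
Lemma feval_lifted02 : f 0 2 = (a * a^* ^+ 2)^-1 *
  ((a * a^*)^-1 * (t 0 2 - b * a^-1 * t 0 4 - b^* * a^*^-1 * t 0 3)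
   + d^* * f 2 4 + e^* * f 2 3).
Proof.
rewrite [LHS]Y0 -!/(f _ _) fd (fC 3) (fC 4) X2 X4 X3 -/(t 0 2) -/(t 0 4) -/(t 0 3).
by rewrite mulr0 addr0 !mulrNN !mulNr !mulrA.
Qed.

End FieldValues.

Lemma antisym_dsigma : antisym lifted_dsigma.
Proof. exact/antisymZ/(dcoframe_antisym adapted). Qed.

Lemma antisym_drho : antisym lifted_drho.
Proof. by do 2?[apply: antisymD]; exact/antisymZ/(dcoframe_antisym adapted). Qed.

Lemma antisym_dzeta : antisym lifted_dzeta.
Proof. by do 3?[apply: antisymD]; exact/antisymZ/(dcoframe_antisym adapted). Qed.

(** As [[L, T] = S], the form [d sigma_0] is 1 on [(T, L)] and 0 on [(T, Lb)] and [(L, Lb)]. That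
    single 1 produces the terms in [c], in its conjugate and in the conjugate of [d]; the terms in
    [b] and its conjugate come from the [L] and [Lb] components of [dual_rho]. *)
Lemma dsigma_essential (f := fun j k => feval lifted_dsigma (lifted_field j) (lifted_field k)) :
  [/\ f 1%N 4%N = a^-1 * Q - c / (a ^+ 2 * a^*),
      f 1%N 3%N = a^*^-1 * B,
      f 0%N 2%N = (a^* ^+ 2)^-1 * G^* - b / (a * a^* ^+ 2) * B
                  - b^* / a^* ^+ 3 * R^* + d^* / (a * a^* ^+ 2),
      f 0%N 4%N = a^*^-1 * B - c^* / (a * a^* ^+ 2)
    & f 0%N 3%N = a / a^* ^+ 2 * R^*].
Proof.
have aD := dcoframe_antisym adapted 1%N.
pose t j k := feval (dw 1%N) (X j) (X k).
pose g j k := feval (dw 1%N) (lifted_field j) (lifted_field k).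
have fg j k : f j k = (a ^+ 2 * a^*) * g j k by exact: fevalZ.
have T24 : t 2%N 4%N = 1 by exact: (dcoframe_TL adapted).
have T23 : t 2%N 3%N = 0 by exact: (dcoframe_TLb adapted).
have T43 : t 4%N 3%N = 0 by apply: etrans (dcoframe_LLb adapted _) _; rewrite ?mulr0.
have T14 : t 1%N 4%N = Q by exact: (dsigma_SL adapted).
have T13 : t 1%N 3%N = B by exact: (dsigma_SLb adapted).
have T04 : t 0%N 4%N = B by exact: (dsigma_SbL adapted).
have T03 : t 0%N 3%N = R^* by exact: (dsigma_SbLb adapted).
have T02 : t 0%N 2%N = G^* by exact: (dsigma_SbT adapted).
have F43 : g 4%N 3%N = (a * a^*)^-1 * t 4%N 3%N by exact: feval_lifted43.
have F24 : g 2%N 4%N = (a * a^*)^-1 *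
    (a^-1 * t 2%N 4%N + b^* * (a * a^*)^-1 * t 4%N 3%N) by exact: feval_lifted24.
have F23 : g 2%N 3%N = (a * a^*)^-1 *
    (a^*^-1 * t 2%N 3%N - b * (a * a^*)^-1 * t 4%N 3%N) by exact: feval_lifted23.
have F14 : g 1%N 4%N = (a ^+ 2 * a^*)^-1 *
    (a^-1 * t 1%N 4%N - c * g 2%N 4%N + d * g 4%N 3%N) by exact: feval_lifted14.
have F13 : g 1%N 3%N = (a ^+ 2 * a^*)^-1 *
    (a^*^-1 * t 1%N 3%N - c * g 2%N 3%N - e * g 4%N 3%N) by exact: feval_lifted13.
have F04 : g 0%N 4%N = (a * a^* ^+ 2)^-1 *
    (a^-1 * t 0%N 4%N - c^* * g 2%N 4%N + e^* * g 4%N 3%N) by exact: feval_lifted04.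
have F03 : g 0%N 3%N = (a * a^* ^+ 2)^-1 *
    (a^*^-1 * t 0%N 3%N - c^* * g 2%N 3%N - d^* * g 4%N 3%N) by exact: feval_lifted03.
have F02 : g 0%N 2%N = (a * a^* ^+ 2)^-1 *
    ((a * a^*)^-1 * (t 0%N 2%N - b * a^-1 * t 0%N 4%N - b^* * a^*^-1 * t 0%N 3%N)
     + d^* * g 2%N 4%N + e^* * g 2%N 3%N) by exact: feval_lifted02.
move: f t g fg T24 T23 T43 T14 T13 T04 T03 T02 F43 F24 F23 F14 F13 F04 F03 F02.
move=> f t g fg T24 T23 T43 T14 T13 T04 T03 T02 F43 F24 F23 F14 F13 F04 F03 F02.
by split; rewrite fg ?(F14, F13, F04, F03, F02) ?(F43, F24, F23)
  ?(T24, T23, T43, T14, T13, T04, T03, T02); field; rewrite ?a0 ?ab0.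
Qed.

(** Accounts for the bare term [wedge r z] in the first structure equation, and for the absence of
    the two other products free of [sigma] and [sigmab]. *)
Lemma dsigma_normalized (f := fun j k => feval lifted_dsigma (lifted_field j) (lifted_field k)) :
  [/\ f 2%N 4%N = 1, f 2%N 3%N = 0 & f 4%N 3%N = 0].
Proof.
have aD := dcoframe_antisym adapted 1%N.
have T24 := dcoframe_TL adapted (isT : (1 < 5)%N).
have T23 := dcoframe_TLb adapted (isT : (1 < 5)%N).
have T43 := dcoframe_LLb adapted (isT : (1 < 5)%N).
have F24 := feval_lifted24 aD; have F23 := feval_lifted23 aD; have F43 := feval_lifted43 (dw 1%N).
move: F24 F23 F43; rewrite T24 T23 T43 /= => F24 F23 F43.
by split; rewrite /f fevalZ ?(F24, F23, F43); field; rewrite ?a0 ?ab0.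
Qed.

Lemma drho_LL : feval lifted_drho (lifted_field 4) (lifted_field 3) = 'i.
Proof.
rewrite !fevalD !fevalZ !feval_lifted43.
rewrite !(dcoframe_LLb adapted) //=; field; by rewrite ?a0 ?ab0.
Qed.

(** The first term comes from [d sigma_0 (T, L) = 1], the second from [d rho_0 (L, Lb) = i] through
    the [Lb] component of [dual_rho]. *)
Lemma drho_V8 : feval lifted_drho (lifted_field 2) (lifted_field 4) =
  c / (a ^+ 2 * a^*) + 'i * (b^* / (a * a^*)).
Proof.
rewrite !fevalD !fevalZ !feval_lifted24; try exact: dcoframe_antisym adapted _.
rewrite !(dcoframe_LLb adapted) // !(dcoframe_TL adapted) //=; field; by rewrite ?a0 ?ab0.
Qed.

Lemma dzeta_W10 : feval lifted_dzeta (lifted_field 4) (lifted_field 3) =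
  'i * (b / (a * a^*)).
Proof.
rewrite !fevalD !fevalZ !feval_lifted43.
rewrite !(dcoframe_LLb adapted) //=; field; by rewrite ?a0 ?ab0.
Qed.

(** The form [rho] is real: conjugation swaps [dw 0] with [dw 1] together with their coefficients
    and fixes the remaining term. *)
Lemma conj_drho j k : (j < 5)%N -> (k < 5)%N ->
  (feval lifted_drho (lifted_field j) (lifted_field k))^* =
  feval lifted_drho (lifted_field (conj_index j)) (lifted_field (conj_index k)).
Proof.
move=> j5 k5; rewrite feval_conj !conj_lifted_field //; congr feval.
have E l m : (l < 5)%N -> conj_index l = m -> forall i i', (dw l i i')^* = dw m i i'.
  by move=> l5 <- i i'; rewrite -(dcoframe_conj adapted l5) mxE.
apply/matrixP => i i'; rewrite /lifted_drho !mxE !conjD !conjM.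
rewrite (E 0%N 1%N) // (E 1%N 0%N) // (E 2%N 2%N) // !conjCK; ring.
Qed.

End Lifted.

(** * Structure equations on the total space *)

Section MaurerCartan.
Variables (K : realType) (n : nat).
Notation C := K[i].
Implicit Types da dab db dc dcb dd de s sb r zb z : 'rV[C]_n.+1.

(** Here and in the next two lemmas, [dg g^-1] applied to the lifted coframe gives back [dg] applied
    to the initial one. The right side keeps the unsimplified shape in which the product rule
    delivers the differential of [a^2] times the conjugate of [a]. *)
Lemma mc_sigma da dab s (a : C) : a != 0 ->
  wedge (2 *: (a^-1 *: da) + a^*^-1 *: dab) ((a ^+ 2 * a^*) *: s) =
  wedge (a^* *: (a *: da + a *: da) + (a * a) *: dab) s.
Proof.
move=> a0; have ab0 : a^* != 0 by rewrite conjC_eq0.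
by apply/matrixP => i j; rewrite !mxE; field; rewrite ?a0 ?ab0.
Qed.

Lemma mc_rho da dab dc dcb s sb r (a c : C) : a != 0 ->
  wedge ((a ^+ 2 * a^*)^-1 *: dc - (c / (a ^+ 3 * a^*)) *: da
         - (c / (a ^+ 2 * a^* ^+ 2)) *: dab) ((a ^+ 2 * a^*) *: s)
  + wedge ((a * a^* ^+ 2)^-1 *: dcb - (c^* / (a * a^* ^+ 3)) *: dab
         - (c^* / (a ^+ 2 * a^* ^+ 2)) *: da) ((a * a^* ^+ 2) *: sb)
  + wedge (a^-1 *: da + a^*^-1 *: dab) (c^* *: sb + c *: s + (a * a^*) *: r) =
  wedge dcb sb + wedge dc s + wedge (a^* *: da + a *: dab) r.
Proof.
move=> a0; have ab0 : a^* != 0 by rewrite conjC_eq0.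
by apply/matrixP => i j; rewrite !mxE; field; rewrite ?a0 ?ab0.
Qed.

Lemma mc_zeta da db dd de s sb r z (a b c d e : C) : a != 0 ->
  wedge (- (c / (a ^+ 3 * a^* ^+ 2)) *: db
           + (b * c / (a ^+ 4 * a^* ^+ 2) - e / (a ^+ 3 * a^*)) *: da
           + (a ^+ 2 * a^*)^-1 *: de) ((a ^+ 2 * a^*) *: s)
  + wedge ((a * a^* ^+ 2)^-1 *: dd - (c^* / (a ^+ 2 * a^* ^+ 3)) *: db
           + (b * c^* / (a ^+ 3 * a^* ^+ 3) - d^* / (a ^+ 2 * a^* ^+ 2)) *: da)
      ((a * a^* ^+ 2) *: sb)
  + wedge ((a * a^*)^-1 *: db - (b / (a ^+ 2 * a^*)) *: da)
      (c^* *: sb + c *: s + (a * a^*) *: r)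
  + wedge (a^-1 *: da) (d^* *: sb + e *: s + b *: r + a *: z) =
  wedge dd sb + wedge de s + wedge db r + wedge da z.
Proof.
move=> a0; have ab0 : a^* != 0 by rewrite conjC_eq0.
by apply/matrixP => i j; rewrite !mxE; field; rewrite ?a0 ?ab0.
Qed.

Variables (sb s r zb z : 'rV[C]_n.+1).

(** The added terms are sorted into the basis order of [two_form]: [wedge sb s] becomes
    [- wedge s sb], which is why the shifts are subtracted, and [wedge s s] vanishes. The same holds
    for the [rho] and [zeta] equations. *)
Lemma sigma_equation_rhs (m mb : 'rV[C]_n.+1) (p q l h t u1 u2 u3 u4 u5 u6 u7 : C) :
  wedge (2 *: (m + p *: s + q *: sb + l *: r + h *: z + t *: zb)
    + (mb + p^* *: sb + q^* *: s + l^* *: r + h^* *: zb + t^* *: z)) s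
  + u1 *: wedge s sb + u2 *: wedge s r + u3 *: wedge s z
  + u4 *: wedge s zb + u5 *: wedge sb r + u6 *: wedge sb z
  + u7 *: wedge sb zb + wedge r z =
  wedge (2 *: m + mb) s + two_form sb s r zb z
    (u1 - (2 * q + p^*), u2 - (2 * l + l^*), u3 - (2 * h + t^*), u4 - (2 * t + h^*),
     u5, u6, u7, 1, 0, 0).
Proof. by apply/matrixP => i j; rewrite !mxE; ring. Qed.

Lemma rho_equation_rhs (m1 m1b m2 m2b : 'rV[C]_n.+1)
    (p1 q1 l1 h1 t1 p2 q2 l2 h2 t2 v1 v2 v3 v4 v8 : C) :
  wedge (m2 + p2 *: s + q2 *: sb + l2 *: r + h2 *: z + t2 *: zb) s
  + wedge (m2b + p2^* *: sb + q2^* *: s + l2^* *: r + h2^* *: zb + t2^* *: z) sb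
  + wedge ((m1 + p1 *: s + q1 *: sb + l1 *: r + h1 *: z + t1 *: zb)
    + (m1b + p1^* *: sb + q1^* *: s + l1^* *: r + h1^* *: zb + t1^* *: z)) r
  + v1 *: wedge s sb + v2 *: wedge s r + v3 *: wedge s z
  + v4 *: wedge s zb + v2^* *: wedge sb r + v4^* *: wedge sb z
  + v3^* *: wedge sb zb + v8 *: wedge r z + v8^* *: wedge r zb + 'i *: wedge z zb =
  wedge m2 s + wedge m2b sb + wedge (m1 + m1b) r + two_form sb s r zb z
    (v1 - (q2 - q2^*), v2 - (l2 - p1 - q1^*), v3 - h2, v4 - t2,
     v2^* - (l2^* - p1^* - q1), v4^* - t2^*, v3^* - h2^*, v8 - (h1 + t1^*),
     v8^* - (h1^* + t1), 'i).
Proof. by apply/matrixP => i j; rewrite !mxE; ring. Qed.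

Lemma zeta_equation_rhs (m1 m3 m4 m5 : 'rV[C]_n.+1)
    (p1 q1 l1 h1 t1 p3 q3 l3 h3 t3 p4 q4 l4 h4 t4 p5 q5 l5 h5 t5
     w1 w2 w3 w4 w5 w6 w7 w8 w9 w10 : C) :
  wedge (m3 + p3 *: s + q3 *: sb + l3 *: r + h3 *: z + t3 *: zb) s
  + wedge (m4 + p4 *: s + q4 *: sb + l4 *: r + h4 *: z + t4 *: zb) sb
  + wedge (m5 + p5 *: s + q5 *: sb + l5 *: r + h5 *: z + t5 *: zb) r
  + wedge (m1 + p1 *: s + q1 *: sb + l1 *: r + h1 *: z + t1 *: zb) z
  + w1 *: wedge s sb + w2 *: wedge s r + w3 *: wedge s z
  + w4 *: wedge s zb + w5 *: wedge sb r + w6 *: wedge sb z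
  + w7 *: wedge sb zb + w8 *: wedge r z + w9 *: wedge r zb + w10 *: wedge z zb =
  wedge m3 s + wedge m4 sb + wedge m5 r + wedge m1 z + two_form sb s r zb z
    (w1 - (q3 - p4), w2 - (l3 - p5), w3 - (h3 - p1), w4 - t3,
     w5 - (l4 - q5), w6 - (h4 - q1), w7 - t4, w8 - (h5 - l1), w9 - t5, w10 - t1).
Proof. by apply/matrixP => i j; rewrite !mxE; ring. Qed.

End MaurerCartan.

Section AddPairs.
Variable V : nmodType.
Implicit Types x y : V.

Lemma addr_pairs3 x1 y1 x2 y2 x3 y3 :
  (x1 + y1) + (x2 + y2) + (x3 + y3) = (x1 + x2 + x3) + (y1 + y2 + y3).
Proof. by rewrite (addrACA x1) (addrACA (x1 + x2)). Qed.

Lemma addr_pairs4 x1 y1 x2 y2 x3 y3 x4 y4 :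
  (x1 + y1) + (x2 + y2) + (x3 + y3) + (x4 + y4) =
  (x1 + x2 + x3 + x4) + (y1 + y2 + y3 + y4).
Proof. by rewrite (addr_pairs3 x1) (addrACA (x1 + x2 + x3)). Qed.

End AddPairs.

Section PullbackForms.
Variables (K : realType) (p q : nat).
Notation C := K[i].
Notation pb v := (row_mx v 0 : 'rV[C]_(p.+1 + q)).
Implicit Types u v : 'rV[C]_p.+1.

Lemma pullback2_inj : injective (@pullback2 K p q).
Proof. by move=> A B /(congr1 (@ulsubmx _ p.+1 q p.+1 q)); rewrite !block_mxKul. Qed.

Lemma pullback2D A B : @pullback2 K p q (A + B) = pullback2 q A + pullback2 q B.
Proof. by rewrite /pullback2 add_block_mx !addr0. Qed.

Lemma pullback2Z c A : @pullback2 K p q (c *: A) = c *: pullback2 q A.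
Proof. by rewrite /pullback2 scale_block_mx !scaler0. Qed.

Lemma pullback2_comb3 a b c A B D :
  @pullback2 K p q (a *: A + b *: B + c *: D) =
  a *: pullback2 q A + b *: pullback2 q B + c *: pullback2 q D.
Proof. by rewrite !(pullback2D, pullback2Z). Qed.

Lemma pullback2_comb4 a b c d A B D E :
  @pullback2 K p q (a *: A + b *: B + c *: D + d *: E) =
  a *: pullback2 q A + b *: pullback2 q B + c *: pullback2 q D + d *: pullback2 q E.
Proof. by rewrite !(pullback2D, pullback2Z). Qed.

Lemma pullbackD u v : pb (u + v) = pb u + pb v.
Proof. by rewrite add_row_mx addr0. Qed.

Lemma pullbackZ c u : pb (c *: u) = c *: pb u.
Proof. by rewrite scale_row_mx scaler0. Qed.

Lemma wedge_pullback u v :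
  @wedge K (p + q) (pb u) (pb v) = pullback2 q (wedge u v).
Proof.
apply/matrixP => i j; rewrite /pullback2.
case: (@split_ordP p.+1 q i) => i' ->; case: (@split_ordP p.+1 q j) => j' ->;
  rewrite ?(@block_mxEul _ p.+1 q p.+1 q, @block_mxEur _ p.+1 q p.+1 q,
    @block_mxEdl _ p.+1 q p.+1 q, @block_mxEdr _ p.+1 q p.+1 q) [LHS]mxE
    ?(@row_mxEl _ _ p.+1 q) ?(@row_mxEr _ _ p.+1 q) [RHS]mxE ?[(0 : 'rV_q) _ _]mxE;
  by rewrite ?(mulr0, mul0r, subr0).
Qed.

Lemma two_form_pullback sb s r zb z c :
  @two_form K (p + q) (pb sb) (pb s) (pb r) (pb zb) (pb z) c =
  pullback2 q (two_form sb s r zb z c).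
Proof.
case: c => [[[[[[[[[c1 c2] c3] c4] c5] c6] c7] c8] c9] c10].
rewrite /two_form !wedge_pullback.
move: (wedge s sb) (wedge s r) (wedge s z) (wedge s zb) (wedge sb r) (wedge sb z)
  (wedge sb zb) (wedge r z) (wedge r zb) (wedge z zb).
by move=> *; rewrite !pullback2D !pullback2Z.
Qed.

Lemma conj_pullback u : @conj_row K (p + q) (pb u) = pb (conj_row u).
Proof.
apply/rowP => j; case: (@split_ordP p.+1 q j) => j' ->; rewrite [LHS]mxE
  ?(@row_mxEl _ _ p.+1 q) ?(@row_mxEr _ _ p.+1 q) ?[RHS]mxE //.
by rewrite mxE conjC0.
Qed.

End PullbackForms.

(** * Separation of the Maurer-Cartan part from the basic part on [M x G] *)

Section TotalSpace.
Variables (K : realType) (Om : set 'rV[K]_5) (Lb : 'rV[K]_5 -> 'rV[K[i]]_5).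
Variables (P Q R A B E' F G : 'rV[K]_5 -> K[i]).
Hypotheses (Om_open : open Om) (Lb_smooth : smooth_row Om Lb).
Hypothesis M_maxmin : maximally_minimal Lb Om.
Hypothesis brackets : bracket_relations Lb Om P Q R A B E' F G.
Notation C := K[i].
Notation MG := 'rV[K]_(5 + (5 + 5)).

Notation coframe x := (fun i => dual_form Lb i (base x)).
Notation dcoframe x := (fun i => dform (dual_form Lb i) (base x)).
Notation fields x := (fun j => frame_field Lb j (base x)).

Lemma has_partial_param k (x : MG) j : has_partial (@param K k) x j.
Proof. exact: is_partialP (is_partial_coord _ _ _ _). Qed.

Lemma has_partial_paramC k (x : MG) j : has_partial (fun y : MG => (@param K k y)^*) x j.
Proof. exact: is_partialP (is_partial_conj (has_partial_param k x j)). Qed.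

Lemma sigmaE x : sigma Lb x = row_mx (lifted_sigma (coframe x) (ga x)) 0.
Proof. by rewrite /sigma /lifted_sigma pullbackZ. Qed.

Lemma rhoE x : rho Lb x = row_mx (lifted_rho (coframe x) (ga x) (gc x)) 0.
Proof. by rewrite /rho /lifted_rho !pullbackD !pullbackZ. Qed.

Lemma zetaE x : zeta Lb x =
  row_mx (lifted_zeta (coframe x) (ga x) (gb x) (gd x) (ge x)) 0.
Proof. by rewrite /zeta /lifted_zeta !pullbackD !pullbackZ. Qed.

Lemma sigmabE x : sigmab Lb x = row_mx (conj_row (lifted_sigma (coframe x) (ga x))) 0.
Proof. by rewrite /sigmab sigmaE; exact: (@conj_pullback K 4 (5 + 5)). Qed.

Lemma zetabE x : zetab Lb x =
  row_mx (conj_row (lifted_zeta (coframe x) (ga x) (gb x) (gd x) (ge x))) 0.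
Proof. by rewrite /zetab zetaE; exact: (@conj_pullback K 4 (5 + 5)). Qed.

Lemma dform_pullback_dual i (g : MG -> C) x : Om (base x) ->
  (forall k, has_partial g x k) ->
  dform (fun y => g y *: pullback (dual_form Lb i) y) x =
  wedge (dfun g x) (pullback (dual_form Lb i) x)
  + g x *: pullback2 (5 + 5) (dform (dual_form Lb i) (base x)).
Proof.
move=> Ox Hg; have Hd := has_partials_dual Om_open Lb_smooth M_maxmin i Ox.
apply: etrans (dformZ Hg (@has_partials_row_pullback K 4 (5 + 5) _ x Hd)) _.
by congr (_ + _ *: _); exact: (dform_pullback Hd).
Qed.

Lemma has_partials_dual_pullback i (g : MG -> C) x : Om (base x) ->
  (forall k, has_partial g x k) ->
  has_partials_row (fun y => g y *: pullback (dual_form Lb i) y) x.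
Proof.
move=> Ox Hg; have Hd := has_partials_dual Om_open Lb_smooth M_maxmin i Ox.
by apply: has_partials_rowZ => //; exact: (has_partials_row_pullback Hd).
Qed.

Lemma adapted_at x : Om (base x) ->
  adapted_frame (fields x) (coframe x) (dcoframe x) (Q (base x)) (R (base x))
    (B (base x)) (G (base x)).
Proof. exact: (frame_adapted Om_open Lb_smooth M_maxmin brackets). Qed.

Lemma dform_sigma x : total_space Om x ->
  dform (sigma Lb) x =
  wedge (2 *: maurer_cartan mc1 x + conj_row (maurer_cartan mc1 x)) (sigma Lb x)
  + pullback2 (5 + 5) (lifted_dsigma (dcoframe x) (ga x)).
Proof.
move=> [Ox a0].
have Hg k : has_partial (fun y : MG => ga y ^+ 2 * (ga y)^*) x k.
  exact: is_partialP (is_partialM (is_partialM (has_partial_param _ x k)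
    (has_partial_param _ x k)) (has_partial_paramC _ x k)).
apply: etrans (dform_pullback_dual 1 Ox Hg) _.
congr (_ + _); last by rewrite /lifted_dsigma pullback2Z.
have -> : dfun (fun y : MG => ga y ^+ 2 * (ga y)^*) x =
    (ga x)^* *: (ga x *: dfun (@ga K) x + ga x *: dfun (@ga K) x)
    + (ga x * ga x) *: dfun (fun y : MG => (ga y)^*) x.
  rewrite (@dfunM _ _ (fun y : MG => ga y ^+ 2)).
  - by rewrite (@dfunM _ _ (@ga K) (@ga K)) //; exact: has_partial_param.
  - by move=> k; exact: is_partialP (is_partialM (has_partial_param _ x k)
      (has_partial_param _ x k)).
  - by move=> k; exact: has_partial_paramC.
rewrite -mc_sigma //; congr (wedge (_ + _) _).
by rewrite conj_rowZ conjV -dfun_conj //; exact: has_partial_param.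
Qed.

Let hp := has_partial_param.
Let hpC := has_partial_paramC.
Let hpa (x : MG) k : has_partial (fun y : MG => ga y * (ga y)^*) x k.
Proof. exact: is_partialP (is_partialM (hp _ x k) (hpC _ x k)). Qed.

Let dconj k (x : MG) : conj_row (dfun (@param K k) x) = dfun (fun y : MG => (param k y)^*) x.
Proof. by rewrite -dfun_conj //; exact: hp. Qed.

Let dconjC k (x : MG) : conj_row (dfun (fun y : MG => (@param K k y)^*) x) = dfun (param k) x.
Proof. by rewrite -dconj conj_rowK. Qed.

Let comb_conj a b c (u v w : 'rV[C]_(5 + (5 + 5))) :
  @conj_row K (4 + (5 + 5)) (a *: u - b *: v - c *: w) =
  a^* *: @conj_row K (4 + (5 + 5)) u - b^* *: @conj_row K (4 + (5 + 5)) v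
  - c^* *: @conj_row K (4 + (5 + 5)) w.
Proof.
rewrite -!scaleNr !conj_rowD !conj_rowZ !conjN.
by [].
Qed.

Lemma conj_mc2 (x : MG) : ga x != 0 -> conj_row (maurer_cartan mc2 x) =
  (ga x * (ga x)^* ^+ 2)^-1 *: dfun (fun y : MG => (gc y)^*) x
  - ((gc x)^* / (ga x * (ga x)^* ^+ 3)) *: dfun (fun y : MG => (ga y)^*) x
  - ((gc x)^* / (ga x ^+ 2 * (ga x)^* ^+ 2)) *: dfun (@ga K) x.
Proof.
move=> a0; apply: etrans (comb_conj _ _ _ _ _ _) _.
rewrite dconj [conj_row (dfun (@ga K) x)]dconj dconjC !(conjM, conjV, conjX, conjCK).
by rewrite [(ga x)^* ^+ 2 * ga x]mulrC [(ga x)^* ^+ 3 * ga x]mulrC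
  [(ga x)^* ^+ 2 * ga x ^+ 2]mulrC.
Qed.

Lemma dform_rho x : total_space Om x ->
  dform (rho Lb) x =
  wedge (maurer_cartan mc2 x) (sigma Lb x)
  + wedge (conj_row (maurer_cartan mc2 x)) (sigmab Lb x)
  + wedge (maurer_cartan mc1 x + conj_row (maurer_cartan mc1 x)) (rho Lb x)
  + pullback2 (5 + 5) (lifted_drho (dcoframe x) (ga x) (gc x)).
Proof.
move=> [Ox a0].
have h0 := has_partials_dual_pullback 0 Ox (hpC 2 x).
have h1 := has_partials_dual_pullback 1 Ox (hp 2 x).
have h2 := has_partials_dual_pullback 2 Ox (hpa x).
apply: etrans (dformD (has_partials_rowD h0 h1) h2) _.
rewrite (dformD h0 h1) !dform_pullback_dual //.
have -> : dfun (fun y : MG => ga y * (ga y)^*) x =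
    (ga x)^* *: dfun (@ga K) x + ga x *: dfun (fun y : MG => (ga y)^*) x.
  by apply: (@dfunM _ _ (@ga K) (fun y : MG => (ga y)^*)); [exact: hp|exact: hpC].
have -> : sigmab Lb x = (ga x * (ga x)^* ^+ 2) *: pullback (dual_form Lb 0) x.
  rewrite sigmabE (conj_lifted_sigma (adapted_at Ox)); exact: pullbackZ.
have e1 : conj_row (maurer_cartan mc1 x) = (ga x)^*^-1 *: dfun (fun y : MG => (ga y)^*) x.
  by rewrite conj_rowZ conjV -dfun_conj //; exact: hp.
rewrite conj_mc2 // e1.
apply: etrans (addr_pairs3 _ _ _ _ _ _) _.
apply: (congr2 +%R); last exact: esym (@pullback2_comb3 K 4 (5 + 5) _ _ _ _ _ _).
exact: esym (mc_rho _ _ _ _ _ _ _ _ a0).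
Qed.

Lemma dform_zeta x : total_space Om x ->
  dform (zeta Lb) x =
  wedge (maurer_cartan mc3 x) (sigma Lb x)
  + wedge (maurer_cartan mc4 x) (sigmab Lb x)
  + wedge (maurer_cartan mc5 x) (rho Lb x)
  + wedge (maurer_cartan mc1 x) (zeta Lb x)
  + pullback2 (5 + 5) (lifted_dzeta (dcoframe x) (ga x) (gb x) (gd x) (ge x)).
Proof.
move=> [Ox a0].
have h0 := has_partials_dual_pullback 0 Ox (hpC 3 x).
have h1 := has_partials_dual_pullback 1 Ox (hp 4 x).
have h2 := has_partials_dual_pullback 2 Ox (hp 1 x).
have h4 := has_partials_dual_pullback 4 Ox (hp 0 x).
apply: etrans (dformD (has_partials_rowD (has_partials_rowD h0 h1) h2) h4) _.
rewrite (dformD (has_partials_rowD h0 h1) h2) (dformD h0 h1) !dform_pullback_dual //.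
have -> : sigmab Lb x = (ga x * (ga x)^* ^+ 2) *: pullback (dual_form Lb 0) x.
  rewrite sigmabE (conj_lifted_sigma (adapted_at Ox)); exact: pullbackZ.
apply: etrans (addr_pairs4 _ _ _ _ _ _ _ _) _.
apply: (congr2 +%R); last exact: esym (@pullback2_comb4 K 4 (5 + 5) _ _ _ _ _ _ _ _).
apply: esym; exact: (mc_zeta (dfun (@ga K) x) (dfun (@gb K) x)
  (dfun (fun y : MG => (gd y)^*) x) (dfun (@ge K) x) (pullback (dual_form Lb 1) x)
  (pullback (dual_form Lb 0) x) (pullback (dual_form Lb 2) x)
  (pullback (dual_form Lb 4) x) (gb x) (gc x) (gd x) (ge x) a0).
Qed.

Definition torsion0 (k : torsion_index) (x : MG) : C :=
  let Y j := lifted_field (fields x) (ga x) (gb x) (gc x) (gd x) (ge x) j in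
  let fs j l := feval (lifted_dsigma (dcoframe x) (ga x)) (Y j) (Y l) in
  let fr j l := feval (lifted_drho (dcoframe x) (ga x) (gc x)) (Y j) (Y l) in
  let fz j l :=
    feval (lifted_dzeta (dcoframe x) (ga x) (gb x) (gd x) (ge x)) (Y j) (Y l) in
  match k with
  | U1 => fs 1%N 0%N | U2 => fs 1%N 2%N | U3 => fs 1%N 4%N | U4 => fs 1%N 3%N
  | U5 => fs 0%N 2%N | U6 => fs 0%N 4%N | U7 => fs 0%N 3%N
  | V1 => fr 1%N 0%N | V2 => fr 1%N 2%N | V3 => fr 1%N 4%N | V4 => fr 1%N 3%N
  | V8 => fr 2%N 4%N
  | W1 => fz 1%N 0%N | W2 => fz 1%N 2%N | W3 => fz 1%N 4%N | W4 => fz 1%N 3%N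
  | W5 => fz 0%N 2%N | W6 => fz 0%N 4%N | W7 => fz 0%N 3%N
  | W8 => fz 2%N 4%N | W9 => fz 2%N 3%N | W10 => fz 4%N 3%N
  end.

(** The change of each coefficient, read off the three [_equation_rhs] lemmas. [U5], [U6], [U7] do
    not move because in the [sigma] equation every modification is wedged with [sigma]. *)
Definition torsion_shift (p q l h t : mc_index -> MG -> C) (k : torsion_index) (x : MG) : C :=
  match k with
  | U1 => 2 * q mc1 x + (p mc1 x)^*
  | U2 => 2 * l mc1 x + (l mc1 x)^*
  | U3 => 2 * h mc1 x + (t mc1 x)^*
  | U4 => 2 * t mc1 x + (h mc1 x)^*
  | U5 | U6 | U7 => 0
  | V1 => q mc2 x - (q mc2 x)^*
  | V2 => l mc2 x - p mc1 x - (q mc1 x)^*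
  | V3 => h mc2 x
  | V4 => t mc2 x
  | V8 => h mc1 x + (t mc1 x)^*
  | W1 => q mc3 x - p mc4 x
  | W2 => l mc3 x - p mc5 x
  | W3 => h mc3 x - p mc1 x
  | W4 => t mc3 x
  | W5 => l mc4 x - q mc5 x
  | W6 => h mc4 x - q mc1 x
  | W7 => t mc4 x
  | W8 => h mc5 x - l mc1 x
  | W9 => t mc5 x
  | W10 => t mc1 x
  end.

Let tuple_eq (x1 x2 x3 x4 x8 y5 y6 y7 y9 y10 z5 z6 z7 z9 z10 : C) :
  z5 = y5 -> z6 = y6 -> z7 = y7 -> z9 = y9 -> y10 = z10 ->
  (x1, x2, x3, x4, y5, y6, y7, x8, y9, y10) = (x1, x2, x3, x4, z5, z6, z7, x8, z9, z10).
Proof. by move=> -> -> -> -> ->. Qed.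

Let coefficients_at x := coefficients (fields x) (ga x) (gb x) (gc x) (gd x) (ge x).

Lemma coefficients_dsigma x : total_space Om x ->
  coefficients_at x (lifted_dsigma (dcoframe x) (ga x)) =
  (torsion0 U1 x, torsion0 U2 x, torsion0 U3 x, torsion0 U4 x, torsion0 U5 x,
   torsion0 U6 x, torsion0 U7 x, 1, 0, 0).
Proof.
move=> [Ox a0]; have ad := adapted_at Ox.
have [e1 e2 e3] := dsigma_normalized ad (gb x) (gc x) (gd x) (ge x) a0.
by rewrite -[1]e1 -[X in (_, X, _)]e2 -[X in (_, X)]e3.
Qed.

Lemma coefficients_drho x : total_space Om x ->
  coefficients_at x (lifted_drho (dcoframe x) (ga x) (gc x)) =
  (torsion0 V1 x, torsion0 V2 x, torsion0 V3 x, torsion0 V4 x, (torsion0 V2 x)^*,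
   (torsion0 V4 x)^*, (torsion0 V3 x)^*, torsion0 V8 x, (torsion0 V8 x)^*, 'i).
Proof.
move=> [Ox a0]; have ad := adapted_at Ox.
pose f j k := feval (lifted_drho (dcoframe x) (ga x) (gc x))
  (lifted_field (fields x) (ga x) (gb x) (gc x) (gd x) (ge x) j)
  (lifted_field (fields x) (ga x) (gb x) (gc x) (gd x) (ge x) k).
have e43 : f 4%N 3%N = 'i by exact: (drho_LL ad (gb x) (gc x) (gd x) (ge x) a0).
have c j k : (j < 5)%N -> (k < 5)%N -> (f j k)^* = f (conj_index j) (conj_index k).
  by move=> j5 k5; exact: (conj_drho ad).
have e2 : (torsion0 V2 x)^* = f 0%N 2%N by exact: (c 1%N 2%N).
have e4 : (torsion0 V4 x)^* = f 0%N 4%N by exact: (c 1%N 3%N).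
have e3 : (torsion0 V3 x)^* = f 0%N 3%N by exact: (c 1%N 4%N).
have e8 : (torsion0 V8 x)^* = f 2%N 3%N by exact: (c 2%N 4%N).
exact: (tuple_eq _ _ _ _ _ e2 e4 e3 e8 e43).
Qed.

(** Conjugation exchanges the dual vectors of [sigma] and [sigmab], so a real 2-form changes sign on
    this pair. *)
Lemma torsion0_V1_imaginary x : total_space Om x ->
  (torsion0 V1 x)^* = - torsion0 V1 x.
Proof.
move=> [Ox a0]; have ad := adapted_at Ox.
apply: etrans (conj_drho ad (ga x) (gb x) (gc x) (gd x) (ge x) (j := 1) (k := 0) _ _) _ => //.
exact: fevalC (antisym_drho ad (ga x) (gc x)).
Qed.

(** Turns an equation between 2-forms on [M x G] into an equality of ten numbers: the pullback is
    injective and the wedge products form a basis. *)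
Lemma two_form_eq x (M : 'M[C]_(5 + (5 + 5))) (D : 'M[C]_5) c :
  total_space Om x -> antisym D ->
  M + @pullback2 K 4 (5 + 5) D =
    M + @two_form K (4 + (5 + 5)) (sigmab Lb x) (sigma Lb x) (rho Lb x) (zetab Lb x) (zeta Lb x) c
  <-> coefficients_at x D = c.
Proof.
move=> [Ox a0] aD; have ad := adapted_at Ox.
have e : two_form (sigmab Lb x) (sigma Lb x) (rho Lb x) (zetab Lb x) (zeta Lb x) c =
    pullback2 (5 + 5) (lifted_two_form (coframe x) (ga x) (gb x) (gc x) (gd x) (ge x) c).
  rewrite sigmabE sigmaE rhoE zetabE zetaE.
  exact: (@two_form_pullback K 4 (5 + 5)).
rewrite e; split.
  by move/addrI/(@pullback2_inj K 4 (5 + 5)) => ->; exact: (coefficientsK ad _ _ _ _ a0).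
by move=> <-; rewrite (lifted_two_formK ad _ _ _ _ a0).
Qed.

Lemma conj_row_modified p q l h t k x : total_space Om x ->
  conj_row (modified_mc Lb p q l h t k x) =
  conj_row (maurer_cartan k x) + (p k x)^* *: sigmab Lb x + (q k x)^* *: sigma Lb x
  + (l k x)^* *: rho Lb x + (h k x)^* *: zetab Lb x + (t k x)^* *: zeta Lb x.
Proof.
move=> [Ox a0]; have ad := adapted_at Ox.
have er : conj_row (rho Lb x) = rho Lb x.
  rewrite rhoE; apply: etrans (@conj_pullback K 4 (5 + 5) _) _.
  by rewrite (conj_lifted_rho ad).
have es : conj_row (sigmab Lb x) = sigma Lb x by exact: conj_rowK.
have ez : conj_row (zetab Lb x) = zeta Lb x by exact: conj_rowK.
rewrite !conj_rowD; apply: (congr2 +%R); last by rewrite conj_rowZ ez.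
apply: (congr2 +%R); last exact: conj_rowZ.
apply: (congr2 +%R); last by rewrite conj_rowZ er.
apply: (congr2 +%R); last by rewrite conj_rowZ es.
by apply: (congr2 +%R); last exact: conj_rowZ.
Qed.

End TotalSpace.

(** * The structure equations as equalities of coefficients *)

Section StructureEquations.
Variables (K : realType) (Om : set 'rV[K]_5) (Lb : 'rV[K]_5 -> 'rV[K[i]]_5).
Variables (P Q R A B E' F G : 'rV[K]_5 -> K[i]).
Hypotheses (Om_open : open Om) (Lb_smooth : smooth_row Om Lb).
Hypothesis M_maxmin : maximally_minimal Lb Om.
Hypothesis brackets : bracket_relations Lb Om P Q R A B E' F G.
Notation C := K[i].
Notation MG := 'rV[K]_(5 + (5 + 5)).
Variables (p q l h t : mc_index -> MG -> C) (tau : torsion_index -> MG -> C).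
Variable x : MG.
Hypothesis Tx : total_space Om x.

Notation tu k := (tau k x).
Notation del k := (torsion_shift p q l h t k x).
Notation t0 k := (torsion0 Lb k x).
Notation al k := (modified_mc Lb p q l h t k x).
Notation alb k := (conj_row (modified_mc Lb p q l h t k x)).
Notation s := (sigma Lb x).
Notation sb := (sigmab Lb x).
Notation r := (rho Lb x).
Notation z := (zeta Lb x).
Notation zb := (zetab Lb x).

Let tuple10_iff7 (T : Type) (x1 x2 x3 x4 x5 x6 x7 y1 y2 y3 y4 y5 y6 y7 c8 c9 c10 : T) :
  (x1, x2, x3, x4, x5, x6, x7, c8, c9, c10) = (y1, y2, y3, y4, y5, y6, y7, c8, c9, c10) <->
  (x1, x2, x3, x4, x5, x6, x7) = (y1, y2, y3, y4, y5, y6, y7).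
Proof. by split=> [[-> -> -> -> -> -> ->]|[-> -> -> -> -> -> ->]]. Qed.

Let tuple10_iff5 (x1 x2 x3 x4 x8 y1 y2 y3 y4 y8 z2 z3 z4 z8 c : C) :
  y2^* = z2 -> y4^* = z4 -> y3^* = z3 -> y8^* = z8 ->
  (x1, x2, x3, x4, x2^*, x4^*, x3^*, x8, x8^*, c) =
  (y1, y2, y3, y4, z2, z4, z3, y8, z8, c) <->
  (x1, x2, x3, x4, x8) = (y1, y2, y3, y4, y8).
Proof. by move=> <- <- <- <-; split=> [[-> -> -> -> _ _ _ -> _]|[-> -> -> -> ->]]. Qed.

Let conj_mod k := conj_row_modified Om_open Lb_smooth M_maxmin brackets p q l h t k Tx.

Let coefficient_iff (D : 'M[C]_5) c M := @two_form_eq _ _ _ _ _ _ _ _ _ _ _ Om_open Lb_smooth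
  M_maxmin brackets x M D c Tx.

Let adx := adapted_at Om_open Lb_smooth M_maxmin brackets (proj1 Tx).

Lemma sigma_equation_iff :
  dform (sigma Lb) x =
        wedge (2 *: al mc1 + alb mc1) s
        + tu U1 *: wedge s sb + tu U2 *: wedge s r + tu U3 *: wedge s z
        + tu U4 *: wedge s zb + tu U5 *: wedge sb r + tu U6 *: wedge sb z
        + tu U7 *: wedge sb zb + wedge r z <->
  (t0 U1, t0 U2, t0 U3, t0 U4, t0 U5, t0 U6, t0 U7) =
  (tu U1 - del U1, tu U2 - del U2, tu U3 - del U3, tu U4 - del U4, tu U5, tu U6, tu U7).
Proof.
rewrite conj_mod /modified_mc.
pose rhs := sigma_equation_rhs sb s r zb z (maurer_cartan mc1 x) (conj_row (maurer_cartan mc1 x))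
  (p mc1 x) (q mc1 x) (l mc1 x) (h mc1 x) (t mc1 x) (tu U1) (tu U2) (tu U3) (tu U4)
  (tu U5) (tu U6) (tu U7).
rewrite {}rhs (dform_sigma Om_open Lb_smooth M_maxmin Tx).
apply: iff_trans (coefficient_iff _ _ (antisym_dsigma adx _)) _.
rewrite (coefficients_dsigma Om_open Lb_smooth M_maxmin brackets Tx).
exact: tuple10_iff7.
Qed.

(** Ten coefficients reduce to five: the last one equals [i] on both sides, and since [rho] is real,
    four others are conjugates of listed ones. *)
Lemma rho_equation_iff :
  dform (rho Lb) x =
        wedge (al mc2) s + wedge (alb mc2) sb + wedge (al mc1 + alb mc1) r
        + tu V1 *: wedge s sb + tu V2 *: wedge s r + tu V3 *: wedge s z
        + tu V4 *: wedge s zb + (tu V2)^* *: wedge sb r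
        + (tu V4)^* *: wedge sb z + (tu V3)^* *: wedge sb zb
        + tu V8 *: wedge r z + (tu V8)^* *: wedge r zb + 'i *: wedge z zb <->
  (t0 V1, t0 V2, t0 V3, t0 V4, t0 V8) =
  (tu V1 - del V1, tu V2 - del V2, tu V3 - del V3, tu V4 - del V4, tu V8 - del V8).
Proof.
rewrite !conj_mod /modified_mc.
pose rhs := rho_equation_rhs sb s r zb z (maurer_cartan mc1 x) (conj_row (maurer_cartan mc1 x))
  (maurer_cartan mc2 x) (conj_row (maurer_cartan mc2 x))
  (p mc1 x) (q mc1 x) (l mc1 x) (h mc1 x) (t mc1 x)
  (p mc2 x) (q mc2 x) (l mc2 x) (h mc2 x) (t mc2 x) (tu V1) (tu V2) (tu V3) (tu V4) (tu V8).
rewrite {}rhs (dform_rho Om_open Lb_smooth M_maxmin brackets Tx).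
apply: iff_trans (coefficient_iff _ _ (antisym_drho adx _ _)) _.
rewrite (coefficients_drho Om_open Lb_smooth M_maxmin brackets Tx).
apply: tuple10_iff5; rewrite /torsion_shift; first by rewrite !(conjD, conjN, conjCK).
- by rewrite conjD conjN.
- by rewrite conjD conjN.
by rewrite conjD conjN conjD conjCK.
Qed.

Lemma zeta_equation_iff :
  dform (zeta Lb) x =
        wedge (al mc3) s + wedge (al mc4) sb + wedge (al mc5) r
        + wedge (al mc1) z
        + tu W1 *: wedge s sb + tu W2 *: wedge s r + tu W3 *: wedge s z
        + tu W4 *: wedge s zb + tu W5 *: wedge sb r + tu W6 *: wedge sb z
        + tu W7 *: wedge sb zb + tu W8 *: wedge r z + tu W9 *: wedge r zb
        + tu W10 *: wedge z zb <->
  (t0 W1, t0 W2, t0 W3, t0 W4, t0 W5, t0 W6, t0 W7, t0 W8, t0 W9, t0 W10) =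
  (tu W1 - del W1, tu W2 - del W2, tu W3 - del W3, tu W4 - del W4, tu W5 - del W5,
   tu W6 - del W6, tu W7 - del W7, tu W8 - del W8, tu W9 - del W9, tu W10 - del W10).
Proof.
rewrite /modified_mc.
pose rhs := zeta_equation_rhs sb s r zb z (maurer_cartan mc1 x) (maurer_cartan mc3 x)
  (maurer_cartan mc4 x) (maurer_cartan mc5 x)
  (p mc1 x) (q mc1 x) (l mc1 x) (h mc1 x) (t mc1 x)
  (p mc3 x) (q mc3 x) (l mc3 x) (h mc3 x) (t mc3 x)
  (p mc4 x) (q mc4 x) (l mc4 x) (h mc4 x) (t mc4 x)
  (p mc5 x) (q mc5 x) (l mc5 x) (h mc5 x) (t mc5 x)
  (tu W1) (tu W2) (tu W3) (tu W4) (tu W5) (tu W6) (tu W7) (tu W8) (tu W9) (tu W10).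
rewrite {}rhs (dform_zeta Om_open Lb_smooth M_maxmin brackets Tx).
exact: coefficient_iff (antisym_dzeta adx _ _ _ _).
Qed.

End StructureEquations.

(** * Essential combinations *)

Section Essential.
Variable K : realType.
Notation C := K[i].
Notation MG := 'rV[K]_(5 + (5 + 5)).
Variables lam mu : torsion_index -> C.

Definition conj_combination (f : torsion_index -> C) : C :=
  \sum_(k <- torsion_indices) (lam k * f k + mu k * (f k)^*).

Lemma conj_combinationE f : conj_combination f =
  let g k := lam k * f k + mu k * (f k)^* in
  g U1 + g U2 + g U3 + g U4 + g U5 + g U6 + g U7 + g V1 + g V2 + g V3 + g V4 + g V8
  + g W1 + g W2 + g W3 + g W4 + g W5 + g W6 + g W7 + g W8 + g W9 + g W10.
Proof. by rewrite /conj_combination !big_cons big_nil /= !addrA addr0. Qed.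

(** Taking [w = 1] and [w = i] gives [u + v = 0] and [u - v = 0]. *)
Lemma conj_independent (u v : C) : (forall w, u * w + v * w^* = 0) -> u = 0 /\ v = 0.
Proof.
move=> H; have h1 := H 1; have hi := H 'i.
move: h1 hi; rewrite conjC1 conjCi !mulr1 mulrN -mulrBl => h1 /eqP.
rewrite mulf_eq0 (negbTE (neq0Ci _)) orbF subr_eq0 => /eqP uv.
move: h1; rewrite uv -mulr2n => /eqP; rewrite mulrn_eq0 => /eqP v0.
by rewrite v0.
Qed.

Hypothesis invariant : forall (p q l h t : mc_index -> C) x,
  conj_combination (fun k => torsion_shift (fun i (_ : MG) => p i)
    (fun i _ => q i) (fun i _ => l i) (fun i _ => h i) (fun i _ => t i) k x) = 0.

Let only (i j : mc_index) (v : C) : C :=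
  match i, j with
  | mc1, mc1 | mc2, mc2 | mc3, mc3 | mc4, mc4 | mc5, mc5 => v
  | _, _ => 0
  end.
Let z (_ : mc_index) : C := 0.

Let inv p q l h t := etrans (esym (conj_combinationE _)) (invariant p q l h t 0).

Let c0 := (@conjC0 C, @conjN K, @conjD K, @conjM K, @conjC_nat C).

Let vanishing k := lam k = 0 /\ mu k = 0.

(** The parameters [l], [h], [t] of [mc2] each move exactly one coefficient. The next two lemmas use
    parameters of [mc3], [mc4] and [mc5] with the same property. *)
Lemma vanishing_V234 : [/\ vanishing V2, vanishing V3 & vanishing V4].
Proof.
split; apply: conj_independent => w.
- by have := inv z z (fun j => only mc2 j w) z z; rewrite /= /z !c0 => <-; ring.
- by have := inv z z z (fun j => only mc2 j w) z; rewrite /= /z !c0 => <-; ring.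
- by have := inv z z z z (fun j => only mc2 j w); rewrite /= /z !c0 => <-; ring.
Qed.

Lemma vanishing_W1234 :
  [/\ vanishing W1, vanishing W2, vanishing W3 & vanishing W4].
Proof.
split; apply: conj_independent => w.
- by have := inv z (fun j => only mc3 j w) z z z; rewrite /= /z !c0 => <-; ring.
- by have := inv z z (fun j => only mc3 j w) z z; rewrite /= /z !c0 => <-; ring.
- by have := inv z z z (fun j => only mc3 j w) z; rewrite /= /z !c0 => <-; ring.
- by have := inv z z z z (fun j => only mc3 j w); rewrite /= /z !c0 => <-; ring.
Qed.

Lemma vanishing_W56789 : [/\ vanishing W5, vanishing W6, vanishing W7, vanishing W8
  & vanishing W9].
Proof.
split; apply: conj_independent => w.
- by have := inv z z (fun j => only mc4 j w) z z; rewrite /= /z !c0 => <-; ring.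
- by have := inv z z z (fun j => only mc4 j w) z; rewrite /= /z !c0 => <-; ring.
- by have := inv z z z z (fun j => only mc4 j w); rewrite /= /z !c0 => <-; ring.
- by have := inv z z z (fun j => only mc5 j w) z; rewrite /= /z !c0 => <-; ring.
- by have := inv z z z z (fun j => only mc5 j w); rewrite /= /z !c0 => <-; ring.
Qed.

Let natmul_eq0 n (u : C) : n.+1%:R * u = 0 -> u = 0.
Proof. by move/eqP; rewrite mulf_eq0 pnatr_eq0 => /eqP. Qed.

(** The parameter [q] of [mc1] moves [U1], [V2] and [W6], and the last two are already excluded. *)
Lemma vanishing_U1 : vanishing U1.
Proof.
have [[lV2 mV2] _ _] := vanishing_V234; have [_ [lW6 mW6] _ _ _] := vanishing_W56789.
have [/natmul_eq0 l1 /natmul_eq0 m1] : 2 * lam U1 = 0 /\ 2 * mu U1 = 0 => //.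
apply: conj_independent => w; have := inv z (fun j => only mc1 j w) z z z.
by rewrite /= /z lV2 mV2 lW6 mW6 !c0 => <-; ring.
Qed.

(** The parameter [l] of [mc1] moves [U2] and the already excluded [W8]. The resulting system in
    [lam U2] and [mu U2] has determinant 3. *)
Lemma vanishing_U2 : vanishing U2.
Proof.
have [_ _ _ [lW8 mW8] _] := vanishing_W56789; have [[lV2 mV2] _ _] := vanishing_V234.
have [e1 e2] : 2 * lam U2 + mu U2 = 0 /\ lam U2 + 2 * mu U2 = 0.
  apply: conj_independent => w.
  have := inv z z (fun j => only mc1 j w) z z.
  by rewrite /= /z lW8 mW8 lV2 mV2 !c0 conjCK => <-; ring.
have m2 : mu U2 = - (2 * lam U2) by rewrite -[LHS]subr0 -e1; ring.
move: e2; rewrite m2 => e2; have l0 : 3 * lam U2 = 0 by rewrite -[RHS]oppr0 -e2; ring.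
by split; rewrite ?m2 (natmul_eq0 l0) // mulr0 oppr0.
Qed.

(** The shift [q - q^*] of [V1] is always imaginary, so only this one relation results; it is
    obtained with [q = i]. *)
Lemma relation_V1 : lam V1 = mu V1.
Proof.
have e : (lam V1 - mu V1) * (2 * 'i) = 0.
  have := inv z (fun j => only mc2 j 'i) z z z.
  by rewrite /= /z !c0 !conjCK !conjCi => <-; ring.
apply/eqP; rewrite -subr_eq0; move/eqP: e.
by rewrite mulf_eq0 mulf_eq0 pnatr_eq0 (negbTE (neq0Ci _)) !orbF.
Qed.

(** With [relation_t1], four equations on the eight coefficients of [U3], [U4], [V8], [W10]. The
    four that stay free, those of [U3] and [U4], match the last two combinations and their
    conjugates. *)
Lemma relation_h1 :
  2 * lam U3 + mu U4 + lam V8 = 0 /\ 2 * mu U3 + lam U4 + mu V8 = 0.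
Proof.
have [_ _ [lW3 mW3] _] := vanishing_W1234.
apply: conj_independent => w.
have := inv z z z (fun j => only mc1 j w) z.
by rewrite /= /z !c0 !conjCK => <-; ring.
Qed.

Lemma relation_t1 :
  mu U3 + 2 * lam U4 + mu V8 + lam W10 = 0 /\ lam U3 + 2 * mu U4 + lam V8 + mu W10 = 0.
Proof.
apply: conj_independent => w.
have := inv z z z z (fun j => only mc1 j w).
by rewrite /= /z !c0 !conjCK => <-; ring.
Qed.

(** Among the combinations and their conjugates, [U3] occurs only in the fourth, which fixes the
    factor [lam U3]. The conjugate of [U4] occurs in the fourth and the fifth, leaving
    [mu U4 - lam U3] for the fifth. The conjugate list arises by exchanging [lam] and [mu]. *)
Lemma combination_five (tau : torsion_index -> MG -> C) x :
  (tau V1 x)^* = - tau V1 x ->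
  conj_combination (fun k => tau k x) =
  \sum_(i < 5) ([:: lam U5; lam U6; lam U7; lam U3; mu U4 - lam U3]`_i
                  * (five_combinations tau x)`_i
                + [:: mu U5; mu U6; mu U7; mu U3; lam U4 - mu U3]`_i
                  * ((five_combinations tau x)`_i)^*).
Proof.
move=> V1x; rewrite conj_combinationE !big_ord_recl big_ord0 /=.
have [[-> ->] [-> ->] [-> ->]] := vanishing_V234.
have [[-> ->] [-> ->] [-> ->] [-> ->]] := vanishing_W1234.
have [[-> ->] [-> ->] [-> ->] [-> ->] [-> ->]] := vanishing_W56789.
have [-> ->] := vanishing_U1; have [-> ->] := vanishing_U2.
(* What is left of [V1] is a multiple of the sum of [V1] and its conjugate, which is zero. *)
rewrite V1x relation_V1.
have [h1 h2] := relation_h1; have [t1 t2] := relation_t1.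
have -> : lam V8 = - (2 * lam U3 + mu U4) by rewrite -[LHS]subr0 -h1; ring.
have -> : mu V8 = - (2 * mu U3 + lam U4) by rewrite -[LHS]subr0 -h2; ring.
have -> : lam W10 = mu U3 - lam U4.
  transitivity (mu U3 - lam U4 + (mu U3 + 2 * lam U4 + mu V8 + lam W10)
    - (2 * mu U3 + lam U4 + mu V8)); first ring.
  by rewrite t1 h2 addr0 subr0.
have -> : mu W10 = lam U3 - mu U4.
  transitivity (lam U3 - mu U4 + (lam U3 + 2 * mu U4 + lam V8 + mu W10)
    - (2 * lam U3 + mu U4 + lam V8)); first ring.
  by rewrite t2 h1 addr0 subr0.
rewrite !(conjD, conjN, conjM, conjCK, conjC_nat); ring.
Qed.

End Essential.

(** * Explicit torsion, its uniqueness, and invariance *)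

Section StructureTheorem.
Variables (K : realType) (Om : set 'rV[K]_5) (Lb : 'rV[K]_5 -> 'rV[K[i]]_5).
Variables (P Q R A B E' F G : 'rV[K]_5 -> K[i]).
Hypotheses (Om_open : open Om) (Lb_smooth : smooth_row Om Lb).
Hypothesis M_maxmin : maximally_minimal Lb Om.
Hypothesis brackets : bracket_relations Lb Om P Q R A B E' F G.
Notation C := K[i].
Notation MG := 'rV[K]_(5 + (5 + 5)).
Implicit Types (p q l h t : mc_index -> MG -> C) (tau : torsion_index -> MG -> C).

Lemma structure_equationsP p q l h t tau :
  structure_equations Lb Om (modified_mc Lb p q l h t) tau <->
  forall x, total_space Om x ->
    forall k, tau k x = torsion0 Lb k x + torsion_shift p q l h t k x.
Proof.
split=> H x Tx.
  have [/(sigma_equation_iff Om_open Lb_smooth M_maxmin brackets _ _ _ _ _ _ Tx)[]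
    s1 s2 s3 s4 s5 s6 s7
    /(rho_equation_iff Om_open Lb_smooth M_maxmin brackets _ _ _ _ _ _ Tx)[]
    r1 r2 r3 r4 r8
    /(zeta_equation_iff Om_open Lb_smooth M_maxmin brackets _ _ _ _ _ _ Tx)[]
    z1 z2 z3 z4 z5 z6 z7 z8 z9 z10] := H x Tx.
  have U (u v w : C) : u = v - w -> v = u + w by move=> ->; rewrite subrK.
  (* The second branch serves [U5], [U6], [U7], whose shift is 0. *)
  by case; first [by apply: U | by apply: U; rewrite subr0].
have V k : torsion0 Lb k x = tau k x - torsion_shift p q l h t k x.
  by rewrite (H x Tx) addrK.
have V0 k : torsion_shift p q l h t k x = 0 -> torsion0 Lb k x = tau k x.
  by move=> e; rewrite V e subr0.
split.
- apply/(sigma_equation_iff Om_open Lb_smooth M_maxmin brackets _ _ _ _ _ _ Tx).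
  by rewrite !V !subr0.
- apply/(rho_equation_iff Om_open Lb_smooth M_maxmin brackets _ _ _ _ _ _ Tx).
  by rewrite !V.
- apply/(zeta_equation_iff Om_open Lb_smooth M_maxmin brackets _ _ _ _ _ _ Tx).
  by rewrite !V.
Qed.

Let zero (_ : mc_index) (_ : MG) : C := 0.

Lemma modified_mc0 : modified_mc Lb zero zero zero zero zero = @maurer_cartan K.
Proof.
have z (u v : 'rV[C]_(5 + (5 + 5))) : u + 0 *: v = u by rewrite scale0r addr0.
by apply/funext => k; apply/funext => x; do 4?[apply: etrans (z _ _) _]; exact: z.
Qed.

Lemma torsion_shift0 k x : torsion_shift zero zero zero zero zero k x = 0.
Proof. by case: k; rewrite /torsion_shift /zero ?conjC0 ?mulr0 ?subr0 ?addr0. Qed.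

Lemma is_torsionP tau : is_torsion Lb Om tau <->
  forall x, total_space Om x -> forall k, tau k x = torsion0 Lb k x.
Proof.
rewrite /is_torsion -modified_mc0; apply: iff_trans (structure_equationsP _ _ _ _ _ _) _.
by split=> H x Tx k; have := H x Tx k; rewrite torsion_shift0 addr0.
Qed.

Lemma five_combinations_torsion0 x : total_space Om x ->
  let a := ga x in let b := gb x in let c := gc x in let d := gd x in
  let m := base x in
  five_combinations (torsion0 Lb) x =
  [:: (a^* ^+ 2)^-1 * (G m)^* - b / (a * a^* ^+ 2) * B m
        - b^* / a^* ^+ 3 * (R m)^* + d^* / (a * a^* ^+ 2);
      (a^*)^-1 * B m - c^* / (a * a^* ^+ 2);
      a / a^* ^+ 2 * (R m)^*;
      a^-1 * Q m - 4 * (c / (a ^+ 2 * a^*)) + a^-1 * (B m)^*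
        - 3 * 'i * (b^* / (a * a^*));
      a^-1 * (B m)^* - c / (a ^+ 2 * a^*)].
Proof.
move=> [Ox a0] a b c d m.
have ad := adapted_at Om_open Lb_smooth M_maxmin brackets Ox.
have [e3 e4 e5 e6 e7] := dsigma_essential ad (gb x) (gc x) (gd x) (ge x) a0.
have e8 := drho_V8 ad (gb x) (gc x) (gd x) (ge x) a0.
have e10 := dzeta_W10 ad (gb x) (gc x) (gd x) (ge x) a0.
have t3 : torsion0 Lb U3 x = a^-1 * Q m - c / (a ^+ 2 * a^*) by exact: e3.
have t4 : torsion0 Lb U4 x = a^*^-1 * B m by exact: e4.
have t5 : torsion0 Lb U5 x = (a^* ^+ 2)^-1 * (G m)^* - b / (a * a^* ^+ 2) * B m
        - b^* / a^* ^+ 3 * (R m)^* + d^* / (a * a^* ^+ 2) by exact: e5.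
have t6 : torsion0 Lb U6 x = (a^*)^-1 * B m - c^* / (a * a^* ^+ 2) by exact: e6.
have t7 : torsion0 Lb U7 x = a / a^* ^+ 2 * (R m)^* by exact: e7.
have t8 : torsion0 Lb V8 x = c / (a ^+ 2 * a^*) + 'i * (b^* / (a * a^*)) by exact: e8.
have t10 : torsion0 Lb W10 x = 'i * (b / (a * a^*)) by exact: e10.
rewrite /five_combinations t3 t4 t5 t6 t7 t8 t10.
rewrite !conjM !conjV !conjM conjCi !conjCK [a^* * a]mulrC.
by congr [:: _; _; _; _; _]; ring.
Qed.

Lemma essential_five (i : 'I_5) :
  essential Lb Om (fun tau x => (five_combinations tau x)`_i).
Proof.
move=> p q l h t tau tau' /is_torsionP H /structure_equationsP H' x Tx.
have e k : tau' k x = tau k x + torsion_shift p q l h t k x by rewrite H // H'.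
congr nth; rewrite /five_combinations !e /torsion_shift !addr0.
by congr [:: _; _; _; _; _]; rewrite !(conjD, conjM, conjCK, conjC_nat); ring.
Qed.

Lemma total_space_point : Om 0 -> exists x : MG, total_space Om x.
Proof.
move=> O0; exists (row_mx 0 (row_mx (const_mx 1) 0)); split.
  by rewrite /base row_mxKl.
rewrite /ga /param row_mxEr row_mxEl row_mxEr row_mxEr !mxE.
by rewrite (_ : Complex 1 0 = 1) ?oner_neq0.
Qed.

(** Essentiality is tested at a single point [y] with constant parameters; such a point must exist,
    since the condition would be vacuous on an empty total space. *)
Lemma essential_invariant lam mu : Om 0 ->
  essential Lb Om (linear_combination lam mu) ->
  forall (p q l h t : mc_index -> C) x,
  conj_combination lam mu (fun k => torsion_shift (fun i (_ : MG) => p i)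
    (fun i _ => q i) (fun i _ => l i) (fun i _ => h i) (fun i _ => t i) k x) = 0.
Proof.
move=> /total_space_point[y Ty] ess p q l h t x.
pose sh := torsion_shift (fun i (_ : MG) => p i) (fun i _ => q i) (fun i _ => l i)
  (fun i _ => h i) (fun i _ => t i).
have t0 : is_torsion Lb Om (torsion0 Lb) by apply/is_torsionP.
have t1 := (structure_equationsP _ _ _ _ _ (fun k z => torsion0 Lb k z + sh k z)).2
  (fun _ _ _ => erefl).
have e : conj_combination lam mu (fun k => torsion0 Lb k y + sh k y) =
    conj_combination lam mu (fun k => torsion0 Lb k y).
  exact: ess t0 t1 y Ty.
transitivity (conj_combination lam mu (fun k => torsion0 Lb k y + sh k y)
  - conj_combination lam mu (fun k => torsion0 Lb k y)); last by rewrite e subrr.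
rewrite -sumrB; apply: eq_bigr => k _; rewrite conjD.
(* With constant parameters the shift does not depend on the point, so [x] may be replaced by
   [y]. *)
have -> : torsion_shift (fun i (_ : MG) => p i) (fun i _ => q i) (fun i _ => l i)
  (fun i _ => h i) (fun i _ => t i) k x = sh k y by case: k.
move: (torsion0 Lb k y) (sh k y) => u v; ring.
Qed.

End StructureTheorem.

Theorem lemma1p8 (K : realType) (Om : set 'rV[K]_5)
    (phi : 'I_3 -> 'rV[K]_5 -> K) (Lb : 'rV[K]_5 -> 'rV[K[i]]_5)
    (P Q R A B E F G : 'rV[K]_5 -> K[i])
    (Om_open : open Om) (Om0 : Om 0)
    (phi_analytic : forall j, real_analytic Om (phi j))
    (phi0 : forall j, phi j 0 = 0)
    (dphi0 : forall j k, rpartial k (phi j) 0 = 0)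
    (Lb_generator : T01_generator Om phi Lb)
    (M_maxmin : maximally_minimal Lb Om)
    (brackets : bracket_relations Lb Om P Q R A B E F G) :
  exists tau : torsion_index -> 'rV[K]_(5 + (5 + 5)) -> K[i],
  [/\ is_torsion Lb Om tau
        /\ (forall tau', is_torsion Lb Om tau' ->
              forall k x, total_space Om x -> tau' k x = tau k x),
      (forall x, total_space Om x ->
        let a := ga x in let b := gb x in let c := gc x in let d := gd x in
        let m := base x in
        five_combinations tau x =
        [:: (a^* ^+ 2)^-1 * (G m)^* - b / (a * a^* ^+ 2) * B m
              - b^* / a^* ^+ 3 * (R m)^* + d^* / (a * a^* ^+ 2);
            (a^*)^-1 * B m - c^* / (a * a^* ^+ 2);
            a / a^* ^+ 2 * (R m)^*;
            a^-1 * Q m - 4 * (c / (a ^+ 2 * a^*)) + a^-1 * (B m)^*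
              - 3 * 'i * (b^* / (a * a^*));
            a^-1 * (B m)^* - c / (a ^+ 2 * a^*)]),
      (forall i : 'I_5,
        essential Lb Om (fun tau' x => (five_combinations tau' x)`_i))
    & (forall lam mu : torsion_index -> K[i],
        essential Lb Om (linear_combination lam mu) ->
        exists cf cf' : 'I_5 -> K[i], forall x, total_space Om x ->
          linear_combination lam mu tau x =
          \sum_(i < 5) (cf i * (five_combinations tau x)`_i
                        + cf' i * ((five_combinations tau x)`_i)^*))].
Proof.
have Lb_smooth : smooth_row Om Lb.
  by apply: smooth_Lb Lb_generator => // j; case: (phi_analytic j).
have torsionP := is_torsionP Om_open Lb_smooth M_maxmin brackets.
exists (torsion0 Lb); split.
- split; first by apply/torsionP.
  by move=> tau' /torsionP H k x Tx; exact: H.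
- move=> x Tx; exact: (five_combinations_torsion0 Om_open Lb_smooth M_maxmin brackets Tx).
- move=> i; exact: (essential_five Om_open Lb_smooth M_maxmin brackets).
move=> lam mu ess.
have inv := essential_invariant Om_open Lb_smooth M_maxmin brackets Om0 ess.
exists (fun i => [:: lam U5; lam U6; lam U7; lam U3; mu U4 - lam U3]`_i).
exists (fun i => [:: mu U5; mu U6; mu U7; mu U3; lam U4 - mu U3]`_i).
move=> x Tx; apply: (combination_five inv).
exact: (torsion0_V1_imaginary Om_open Lb_smooth M_maxmin brackets Tx).
Qed.
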